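(* Let $\boldsymbol\ell=(\ell_1,\ell_2,\ell_3,2)$ with $\ell_1,\ell_2,\ell_3\ge1$ and let $\lambda=(\mathbf a,\mathbf b,\mathbf c,\mathbf d)\in\Lambda(\boldsymbol\ell)$ be of finite type, with $|\lambda|\geq 1$. The following conditions are equivalent: (1) $(\lambda|\lambda)=1$; (2) up to permuting $\mathbf a,\mathbf b,\mathbf c$, up to permutation within each tuple $\mathbf a',\mathbf b',\mathbf c',\mathbf d$, and up to removing the coefficients of $\mathbf a',\mathbf b',\mathbf c'$ which are equal to $0$, $\lambda$ is one of the following. Special cases: $|\lambda|=1$: $((1),(1),(1,0),(0,1))$; $|\lambda|=2$: $((2),(1,1),(1,1),(1,1))$; $|\lambda|=3$: $((1,2),(1,2),(1,2),(1,2))$; $|\lambda|=4$: $((1,3),(1,3),(1,1,2),(2,2))$; $|\lambda|=5$: $((1,4),(1,1,3),(1,1,3),(2,3))$; $|\lambda|=6$: $((1,1,4),(1,1,4),(1,1,4),(2,4))$, $((1,5),(1,1,4),(1^3,3),(3,3))$, $((2,4),(1,1,4),(1,1,4),(3,3))$; $|\lambda|=7$: $((1,6),(1^3,4),(1^3,4),(3,4))$, $((2,5),(1,1,5),(1^3,4),(3,4))$; $|\lambda|=8$: $((2,6),(1^3,5),(1^3,5),(3,5))$, $((2,6),(1,1,6),(1^4,4),(4,4))$, $((2,6),(1,2,5),(1^3,5),(4,4))$; $|\lambda|=9$: $((2,7),(1,2,6),(1^4,5),(4,5))$; $|\lambda|=10$: $((2,8),(1,2,7),(1^5,5),(5,5))$,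 $((2,8),(2,2,6),(1^4,6),(5,5))$, $((3,7),(1,2,7),(1^4,6),(5,5))$; $|\lambda|=11$: $((2,9),(2,2,7),(1^5,6),(5,6))$, $((3,8),(1,2,8),(1^5,6),(5,6))$, $((3,8),(2,2,7),(1^4,7),(5,6))$; $|\lambda|=12$: $((3,9),(2,2,8),(1^5,7),(5,7))$, $((2,10),(2,2,8),(1^6,6),(6,6))$, $((3,9),(2,2,8),(1^3,2,7),(6,6))$. Infinite series with $|\lambda|$ even: $|\lambda|=2k$, $k\geq4$: $((1,2k-1),(1^{k-1},k+1),(1^k,k),(k,k))$; $|\lambda|=4m$, $m\geq3$: $((m,3m),(1,m-1,3m),(1^{2m},2m),(2m,2m))$ and $((m,3m),(1,m,3m-1),(1^{2m-1},2m+1),(2m,2m))$; $|\lambda|=4m+2$, $m\geq3$: $((m,3m+2),(1,m,3m+1),(1^{2m+1},2m+1),(2m+1,2m+1))$ and $((m+1,3m+1),(1,m,3m+1),(1^{2m},2m+2),(2m+1,2m+1))$. Infinite series with $|\lambda|$ odd: $|\lambda|=2k+1$, $k\geq4$: $((1,2k),(1^k,k+1),(1^k,k+1),(k,k+1))$; $|\lambda|=4m+1$, $m\geq3$: $((m,3m+1),(1,m,3m),(1^{2m},2m+1),(2m,2m+1))$; $|\lambda|=4m+3$, $m\geq3$: $((m+1,3m+2),(1,m,3m+2),(1^{2m+1},2m+2),(2m+1,2m+2))$.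
   Context: $\mathbb{K}$ is an algebraically closed field of characteristic zero; $\mathrm{GL}_m=\mathrm{GL}_m(\mathbb{K})$. The notation $i^k$ stands for $k$ consecutive coefficients equal to $i$. For a sequence $\mathbf x$ of nonnegative integers, $|\mathbf x|$ is its sum, and $\mathbf a'=(a_1,\dots,a_{\ell_1-1})$ denotes $\mathbf a$ with its last entry removed (similarly $\mathbf b',\mathbf c'$). For $\boldsymbol\ell=(\ell_1,\ell_2,\ell_3,2)$, $\Lambda(\boldsymbol\ell)$ is the set of nonzero quadruples $\lambda=(\mathbf a,\mathbf b,\mathbf c,\mathbf d)$ of sequences of nonnegative integers of lengths $\ell_1,\ell_2,\ell_3,2$ such that $|\mathbf a|=|\mathbf b|=|\mathbf c|=|\mathbf d|=|\mathbf a'|+|\mathbf b'|+|\mathbf c'|=:|\lambda|$. The Tits form is $(\lambda|\lambda)=\tfrac12\big(\sum_i a_i^2+\sum_j b_j^2+\sum_k c_k^2+d_1^2+d_2^2-2|\lambda|^2\big)$. For $\lambda\in\Lambda(\boldsymbol\ell)$ with $n=|\lambda|$, $\mathfrak X(\lambda)=\mathscr F\!\ell(\mathbf a')\times\mathscr F\!\ell(\mathbf b')\times\mathscr F\!\ell(\mathbf c')\times\mathrm{Gr}(d_1;n)$, where $\mathscr F\!\ell(\mathbf x)$ is the variety of flags $(0=F_0\subset F_1\subset\dots\subset F_k=\mathbb K^{|\mathbf x|})$ with $\dim F_i/F_{i-1}=x_i$, and $\mathrm{Gr}(d;n)$ is the Grassmannian of $d$-dimensional subspaces of $\mathbb K^n=\mathbb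 K^{|\mathbf a'|}\oplus\mathbb K^{|\mathbf b'|}\oplus\mathbb K^{|\mathbf c'|}$. The group $L=\mathrm{GL}_{|\mathbf a'|}\times\mathrm{GL}_{|\mathbf b'|}\times\mathrm{GL}_{|\mathbf c'|}$, embedded block-diagonally in $\mathrm{GL}_n$, acts diagonally on $\mathfrak X(\lambda)$. The vector $\lambda$ is called of finite type if $\mathfrak X(\lambda)$ has finitely many $L$-orbits. *)

(* Defs.v *)
From mathcomp Require Import all_boot all_order all_algebra.
From mathcomp Require Import classical_sets cardinality.

Set Implicit Arguments.
Unset Strict Implicit.
Unset Printing Implicit Defensive.

Import Order.TTheory GRing.Theory Num.Theory.

Local Open Scope nat_scope.

Definition quadruple : Type := (seq nat * seq nat * seq nat * seq nat)%type.

Definition qa (lam : quadruple) : seq nat := lam.1.1.1.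
Definition qb (lam : quadruple) : seq nat := lam.1.1.2.
Definition qc (lam : quadruple) : seq nat := lam.1.2.
Definition qd (lam : quadruple) : seq nat := lam.2.

(* x' : x with its last entry removed. *)
Definition chop (x : seq nat) : seq nat := take (size x).-1 x.

(* |lambda|, defined as |a'| + |b'| + |c'| so that the block decomposition
   K^n = K^|a'| + K^|b'| + K^|c'| holds by conversion. *)
Definition qsize (lam : quadruple) : nat :=
  sumn (chop (qa lam)) + sumn (chop (qb lam)) + sumn (chop (qc lam)).

Definition Lambda (l1 l2 l3 l4 : nat) (lam : quadruple) : Prop :=
  [/\ [/\ size (qa lam) = l1, size (qb lam) = l2,
          size (qc lam) = l3 & size (qd lam) = l4],
      has (fun x => x != 0) (qa lam ++ qb lam ++ qc lam ++ qd lam)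
    & [/\ sumn (qa lam) = qsize lam, sumn (qb lam) = qsize lam,
          sumn (qc lam) = qsize lam & sumn (qd lam) = qsize lam]].

Definition sqsum (x : seq nat) : rat := (\sum_(i <- x) i%:R ^+ 2)%R.

Definition tits (lam : quadruple) : rat :=
  ((sqsum (qa lam) + sqsum (qb lam) + sqsum (qc lam) + sqsum (qd lam)
    - 2 * (qsize lam)%:R ^+ 2) / 2)%R.

Section Varieties.

Variable K : fieldType.

(* The subspace F_i of a flag is entry number i of the tuple, 0 <= i <= k. *)
Definition flag_seq (x : seq nat) : Type :=
  (size x).+1.-tuple {vspace 'cV[K]_(sumn x)}.

Definition is_flag (x : seq nat) (F : flag_seq x) : Prop :=
  [/\ nth 0%VS F 0 = 0%VS,
      nth 0%VS F (size x) = fullv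
    & forall i, i < size x ->
        (nth 0%VS F i <= nth 0%VS F i.+1)%VS /\
        \dim (nth 0%VS F i.+1) - \dim (nth 0%VS F i) = nth 0 x i].

Definition mx_img (m : nat) (g : 'M[K]_m) (U : {vspace 'cV[K]_m}) :
  {vspace 'cV[K]_m} := (linfun (mulmx g : 'cV[K]_m -> 'cV[K]_m) @: U)%VS.

Definition flag_act (x : seq nat) (g : 'M[K]_(sumn x)) (F : flag_seq x) :
  flag_seq x := [tuple of map (mx_img g) F].

Variable lam : quadruple.

Definition point : Type :=
  (flag_seq (chop (qa lam)) * flag_seq (chop (qb lam)) *
   flag_seq (chop (qc lam)) * {vspace 'cV[K]_(qsize lam)})%type.

Definition Xvar : set point :=
  [set p | [/\ is_flag p.1.1.1, is_flag p.1.1.2, is_flag p.1.2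
             & \dim p.2 = nth 0 (qd lam) 0]]%classic.

Definition Lmx : Type :=
  ('M[K]_(sumn (chop (qa lam))) * 'M[K]_(sumn (chop (qb lam))) *
   'M[K]_(sumn (chop (qc lam))))%type.

Definition Lgroup : set Lmx :=
  [set g | [/\ g.1.1 \in unitmx, g.1.2 \in unitmx & g.2 \in unitmx]]%classic.

Definition Lblock (g : Lmx) : 'M[K]_(qsize lam) :=
  block_mx (block_mx g.1.1 0 0 g.1.2) 0 0 g.2.

Definition Lact (g : Lmx) (p : point) : point :=
  (flag_act g.1.1 p.1.1.1, flag_act g.1.2 p.1.1.2, flag_act g.2 p.1.2,
   mx_img (Lblock g) p.2).

Definition Lorbit (p : point) : set point :=
  [set Lact g p | g in Lgroup]%classic.

Definition finite_type : Prop :=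
  finite_set [set Lorbit p | p in Xvar]%classic.

Lemma mx_img_dim m (g : 'M[K]_m) (U : {vspace 'cV[K]_m}) :
  g \in unitmx -> \dim (mx_img g U) = \dim U.
Proof.
move=> gu; apply: limg_dim_eq; apply/eqP; rewrite -subv0; apply/subvP => v.
rewrite memv_cap memv_ker lfunE /= => /andP[_ /eqP gv].
by rewrite memv0 -[v](mulKmx gu) gv mulmx0.
Qed.

Lemma is_flag_act x (g : 'M[K]_(sumn x)) (F : flag_seq x) :
  g \in unitmx -> is_flag F -> is_flag (flag_act g F).
Proof.
move=> gu [F0 Fk Fi].
have E i : i <= size x -> nth 0%VS (flag_act g F) i = mx_img g (nth 0%VS F i).
  by move=> ix; rewrite (nth_map 0%VS) // size_tuple.
split.
- by rewrite E // F0 /mx_img limg0.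
- rewrite E // Fk; apply/eqP; rewrite eqEdim subvf /=.
  by rewrite mx_img_dim.
- move=> i ix; rewrite !E ?(ltnW ix) // !mx_img_dim //.
  by have [le <-] := Fi i ix; split=> //; apply: limgS.
Qed.

Lemma Lblock_unit (g : Lmx) : Lgroup g -> Lblock g \in unitmx.
Proof.
by case=> g1 g2 g3; rewrite unitmxE !det_ublock !unitrM -!unitmxE g1 g2 g3.
Qed.

Lemma Xvar_act (g : Lmx) (p : point) : Lgroup g -> Xvar p -> Xvar (Lact g p).
Proof.
move=> Lg [p1 p2 p3 p4]; have Bu := Lblock_unit Lg; case: Lg => g1 g2 g3.
by split; try exact: is_flag_act; rewrite /= mx_img_dim.
Qed.

End Varieties.

Definition special_cases : seq quadruple := [::
  ([:: 1], [:: 1], [:: 1; 0], [:: 0; 1]);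
  ([:: 2], [:: 1; 1], [:: 1; 1], [:: 1; 1]);
  ([:: 1; 2], [:: 1; 2], [:: 1; 2], [:: 1; 2]);
  ([:: 1; 3], [:: 1; 3], [:: 1; 1; 2], [:: 2; 2]);
  ([:: 1; 4], [:: 1; 1; 3], [:: 1; 1; 3], [:: 2; 3]);
  ([:: 1; 1; 4], [:: 1; 1; 4], [:: 1; 1; 4], [:: 2; 4]);
  ([:: 1; 5], [:: 1; 1; 4], [:: 1; 1; 1; 3], [:: 3; 3]);
  ([:: 2; 4], [:: 1; 1; 4], [:: 1; 1; 4], [:: 3; 3]);
  ([:: 1; 6], [:: 1; 1; 1; 4], [:: 1; 1; 1; 4], [:: 3; 4]);
  ([:: 2; 5], [:: 1; 1; 5], [:: 1; 1; 1; 4], [:: 3; 4]);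
  ([:: 2; 6], [:: 1; 1; 1; 5], [:: 1; 1; 1; 5], [:: 3; 5]);
  ([:: 2; 6], [:: 1; 1; 6], [:: 1; 1; 1; 1; 4], [:: 4; 4]);
  ([:: 2; 6], [:: 1; 2; 5], [:: 1; 1; 1; 5], [:: 4; 4]);
  ([:: 2; 7], [:: 1; 2; 6], [:: 1; 1; 1; 1; 5], [:: 4; 5]);
  ([:: 2; 8], [:: 1; 2; 7], [:: 1; 1; 1; 1; 1; 5], [:: 5; 5]);
  ([:: 2; 8], [:: 2; 2; 6], [:: 1; 1; 1; 1; 6], [:: 5; 5]);
  ([:: 3; 7], [:: 1; 2; 7], [:: 1; 1; 1; 1; 6], [:: 5; 5]);
  ([:: 2; 9], [:: 2; 2; 7], [:: 1; 1; 1; 1; 1; 6], [:: 5; 6]);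
  ([:: 3; 8], [:: 1; 2; 8], [:: 1; 1; 1; 1; 1; 6], [:: 5; 6]);
  ([:: 3; 8], [:: 2; 2; 7], [:: 1; 1; 1; 1; 7], [:: 5; 6]);
  ([:: 3; 9], [:: 2; 2; 8], [:: 1; 1; 1; 1; 1; 7], [:: 5; 7]);
  ([:: 2; 10], [:: 2; 2; 8], [:: 1; 1; 1; 1; 1; 1; 6], [:: 6; 6]);
  ([:: 3; 9], [:: 2; 2; 8], [:: 1; 1; 1; 2; 7], [:: 6; 6])].

Inductive infinite_series : quadruple -> Prop :=
| series_2k k of 4 <= k : infinite_series
    ([:: 1; 2 * k - 1], rcons (nseq (k - 1) 1) (k + 1),
     rcons (nseq k 1) k, [:: k; k])
| series_4m_1 m of 3 <= m : infinite_series
    ([:: m; 3 * m], [:: 1; m - 1; 3 * m],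
     rcons (nseq (2 * m) 1) (2 * m), [:: 2 * m; 2 * m])
| series_4m_2 m of 3 <= m : infinite_series
    ([:: m; 3 * m], [:: 1; m; 3 * m - 1],
     rcons (nseq (2 * m - 1) 1) (2 * m + 1), [:: 2 * m; 2 * m])
| series_4m2_1 m of 3 <= m : infinite_series
    ([:: m; 3 * m + 2], [:: 1; m; 3 * m + 1],
     rcons (nseq (2 * m + 1) 1) (2 * m + 1), [:: 2 * m + 1; 2 * m + 1])
| series_4m2_2 m of 3 <= m : infinite_series
    ([:: m + 1; 3 * m + 1], [:: 1; m; 3 * m + 1],
     rcons (nseq (2 * m) 1) (2 * m + 2), [:: 2 * m + 1; 2 * m + 1])
| series_2k1 k of 4 <= k : infinite_series
    ([:: 1; 2 * k], rcons (nseq k 1) (k + 1),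
     rcons (nseq k 1) (k + 1), [:: k; k + 1])
| series_4m1 m of 3 <= m : infinite_series
    ([:: m; 3 * m + 1], [:: 1; m; 3 * m],
     rcons (nseq (2 * m) 1) (2 * m + 1), [:: 2 * m; 2 * m + 1])
| series_4m3 m of 3 <= m : infinite_series
    ([:: m + 1; 3 * m + 2], [:: 1; m; 3 * m + 2],
     rcons (nseq (2 * m + 1) 1) (2 * m + 2), [:: 2 * m + 1; 2 * m + 2]).

Definition in_table (mu : quadruple) : Prop :=
  mu \in special_cases \/ infinite_series mu.

(* Equality up to permuting x' and removing zeros from x'; the last entry is
   never moved or removed. *)
Definition sim_tuple (x y : seq nat) : bool :=
  (last 0 x == last 0 y) &&
  perm_eq [seq i <- chop x | i != 0] [seq i <- chop y | i != 0].

Definition sim_quadruple (lam mu : quadruple) : Prop :=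
  exists x y z : seq nat,
    [/\ perm_eq [:: qa lam; qb lam; qc lam] [:: x; y; z],
        sim_tuple x (qa mu), sim_tuple y (qb mu), sim_tuple z (qc mu)
      & perm_eq (qd lam) (qd mu)].

(* Main.v *)
Require Import Defs.
From mathcomp Require Import classical_sets cardinality.
From mathcomp Require Import all_boot all_order all_algebra.
From mathcomp Require Import zify.

(* Finite type forbids lambda from containing one of the isotropic roots of the
   affine diagrams E6~, E7~, E8~, namely ((1,1),(1,1),(1,1),(3,3)),
   ((2),(1,1,1),(1,1,1),(4,4)), ((3),(2,2),(1^5),(6,6)) written with a', b', c':
   each of them carries a family of pairwise non-isomorphic configurations indexed
   by t in K, and adding a fixed sum of coordinate lines keeps them
   non-isomorphic.

   Conversely, a vector containing none of these roots has Tits form at least 1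
   (induction: subtract a vector with |.| = 1). If moreover the form equals 1, the
   same subtraction gives a_i + |a'| <= s + 1 for every nonzero part a_i, where
   s = min(d_1, d_2), and likewise for b and c. Summing these inequalities weighted
   by the parts yields max(d_1, d_2) <= s + 2. A case analysis on the number of
   parts then leaves the infinite series and finitely many vectors with s <= 8,
   which are enumerated. *)

Set Implicit Arguments.
Unset Strict Implicit.
Unset Printing Implicit Defensive.

Import GRing.Theory.
Local Open Scope nat_scope.

(** * Combinatorics of the Tits form *)

(** The three roots come out of one average. If [i + |a'| <= s] for each of the k nonzero parts i of
    a', then |a'| <= s k/(k + 1). Three such bounds can add up to 2s only when the three fractions
    1/(k + 1) sum to at most 1, and the minimal triples of values k + 1 are (3,3,3), (2,4,4),
    (2,3,6): the branch lengths, centre included, of E6~, E7~, E8~. Excluding the roots therefore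
    keeps |a'| + |b'| + |c'| below 2s, whereas it equals d_1 + d_2 >= 2s. A form at most 0 would
    give these bounds, hence the lower bound 1; form 1 gives them with s + 1 for s, and the table
    lists what fits into the room so gained. On the geometric side all flags are kept standard and
    only U varies, so equality of orbits becomes an identity between block-triangular matrices.
    Extra coordinate lines, inside or outside U, cannot mix with the model because its U meets each
    arm in 0 and projects onto each arm. *)

Definition ssq (x : seq nat) : nat := sumn [seq i ^ 2 | i <- x].
(** Eliminating the last entries by |a| = |b| = |c| = s + t turns twice the Tits form into
    [arm a' + arm b' + arm c' - 2 * (s * t)]. *)
Definition arm (x : seq nat) : nat := ssq x + sumn x ^ 2.

(** Multiply the inequality for i by i and add. For [p = sumn x] the left side is [arm x]. *)
Lemma ssq_le x p m :
  all (fun i => i + p <= m) x -> ssq x + p * sumn x <= m * sumn x.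
Proof.
rewrite /ssq; elim: x => [|i x IH] /=; first by lia.
by case/andP=> ipm /IH; nia.
Qed.

Lemma sumn_size_le x p m :
  all (fun i => i + p <= m) x -> sumn x + p * size x <= m * size x.
Proof.
elim: x => [|i x IH] /=; first by lia.
by case/andP=> ipm /IH; nia.
Qed.

Lemma size_le_sumn x : all (leq 1) x -> size x <= sumn x.
Proof. by elim: x => //= i x IH /andP[i1 /IH]; lia. Qed.

Lemma cauchy_ssq x : sumn x ^ 2 <= size x * ssq x.
Proof.
rewrite /ssq; elim: x => [|i x IH] //=.
have : 2 * i * sumn x <= size x * i ^ 2 + sumn [seq j ^ 2 | j <- x].
  elim: {IH} x => [|j x IH] /=; first by lia.
  have : 2 * i * j <= i ^ 2 + j ^ 2 by rewrite -mulnA nat_Cauchy.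
  by nia.
by nia.
Qed.

Lemma perm_ssq x y : perm_eq x y -> ssq x = ssq y.
Proof. by move=> xy; apply: perm_sumn; apply: perm_map. Qed.

Lemma perm_arm x y : perm_eq x y -> arm x = arm y.
Proof. by move=> xy; rewrite /arm (perm_ssq xy) (perm_sumn xy). Qed.

(* Some null root of E6~, E7~, E8~ lies below (a, b, c, (d_1, d_2)), where a, b, c
   omit the last entries and s = min(d_1, d_2). *)
Definition null (a b c : seq nat) (s : nat) : bool :=
  [|| [&& 2 <= count (leq 1) a, 2 <= count (leq 1) b, 2 <= count (leq 1) c
        & 3 <= s],
      [&& 1 <= count (leq 2) a, 3 <= count (leq 1) b, 3 <= count (leq 1) c
        & 4 <= s]
    | [&& 1 <= count (leq 3) a, 2 <= count (leq 2) b, 5 <= count (leq 1) c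
        & 6 <= s]].

Definition tame (a b c : seq nat) (s : nat) : bool :=
  ~~ [|| null a b c s, null a c b s, null b a c s,
         null b c a s, null c a b s | null c b a s].

(** Entrywise comparison after sorting and removal of zeros, phrased through the counts on which
    [null] depends. *)
Definition dom (x y : seq nat) : Prop :=
  forall m, count (leq m.+1) x <= count (leq m.+1) y.

Lemma null_mono a b c s a' b' c' s' : dom a a' -> dom b b' -> dom c c' ->
  s <= s' -> null a b c s -> null a' b' c' s'.
Proof.
move=> da db dc ss; rewrite /null.
move: (da 0) (da 1) (da 2) (db 0) (db 1) (dc 0) => ? ? ? ? ? ?.
by case/or3P=> /and4P[? ? ? ?]; apply/or3P;
  [apply: Or31 | apply: Or32 | apply: Or33]; apply/and4P; split; lia.
Qed.

Lemma tame_mono a b c s a' b' c' s' : dom a a' -> dom b b' -> dom c c' ->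
  s <= s' -> tame a' b' c' s' -> tame a b c s.
Proof.
move=> da db dc ss; apply: contra.
by case/or4P=> [H|H|H|/or3P[H|H|H]];
  [ have := null_mono da db dc ss H | have := null_mono da dc db ss H
  | have := null_mono db da dc ss H | have := null_mono db dc da ss H
  | have := null_mono dc da db ss H | have := null_mono dc db da ss H ];
  move=> ->; rewrite ?orbT.
Qed.

Lemma tameC12 a b c s : tame a b c s = tame b a c s.
Proof.
rewrite /tame; congr (~~ _).
by case: (null a b c s) (null a c b s) (null b a c s) (null b c a s)
  (null c a b s) (null c b a s) => [] [] [] [] [] [].
Qed.

Lemma tameC23 a b c s : tame a b c s = tame a c b s.
Proof.
rewrite /tame; congr (~~ _).
by case: (null a b c s) (null a c b s) (null b a c s) (null b c a s)
  (null c a b s) (null c b a s) => [] [] [] [] [] [].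
Qed.

Lemma dom_pred x i : i.+1 \in x -> dom (i :: rem i.+1 x) x.
Proof.
move=> ix m; rewrite (permP (perm_to_rem ix)) /=.
by rewrite leq_add2r; case: leqP => // /leqW ->.
Qed.

Lemma sumn_pred x i : i.+1 \in x -> (sumn (i :: rem i.+1 x)).+1 = sumn x.
Proof. by move=> ix; rewrite (perm_sumn (perm_to_rem ix)). Qed.

Lemma arm_pred x i : i.+1 \in x ->
  arm (i :: rem i.+1 x) + 2 * i + 2 * sumn x = arm x.
Proof.
move=> ix; rewrite (perm_arm (perm_to_rem ix)) (perm_sumn (perm_to_rem ix)).
by rewrite /arm /ssq /=; nia.
Qed.

Definition pos (x : seq nat) : seq nat := [seq i <- x | i != 0].

Lemma sumn_pos x : sumn (pos x) = sumn x.
Proof. by elim: x => //= -[|i] x /= ->. Qed.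

Lemma ssq_pos x : ssq (pos x) = ssq x.
Proof. by rewrite /ssq; elim: x => //= -[|i] x /= ->. Qed.

Lemma arm_pos x : arm (pos x) = arm x.
Proof. by rewrite /arm ssq_pos sumn_pos. Qed.

Lemma pos_gt0 x : all (leq 1) (pos x).
Proof. by elim: x => //= -[|i] x /=. Qed.

Lemma count_pos x m : count (leq m.+1) (pos x) = count (leq m.+1) x.
Proof. by elim: x => //= -[|i] x /= ->. Qed.

Lemma tame_pos a b c s : tame (pos a) (pos b) (pos c) s = tame a b c s.
Proof. by rewrite /tame /null !count_pos. Qed.

Lemma count_ge1 x : all (leq 1) x -> count (leq 1) x = size x.
Proof. by rewrite all_count => /eqP. Qed.

Lemma sumn_lt x s : 0 < s -> all (fun i => i + sumn x <= s) x -> sumn x < s.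
Proof. by move=> s0 /sumn_size_le; nia. Qed.

(** Averaging over the k parts of a tuple bounds its sum by s k/(k + 1). Part numbers for which
    three such bounds reach 2s are those of an excluded root; the work is to see that the parts and
    s are then large enough as well. *)
Lemma tame_sorted_sum a b c s :
  all (leq 1) a -> all (leq 1) b -> all (leq 1) c ->
  size a <= size b <= size c -> 0 < s -> tame a b c s ->
  all (fun i => i + sumn a <= s) a -> all (fun i => i + sumn b <= s) b ->
  all (fun i => i + sumn c <= s) c -> sumn a + sumn b + sumn c < 2 * s.
Proof.
move=> a0 b0 c0 /andP[ab bc] s0.
rewrite /tame negb_or => /andP[+ _]; rewrite /null !count_ge1 //.
move=> N bA bB bC.
have rs := sumn_lt s0 bC; have qs := sumn_lt s0 bB.
have := sumn_size_le bA; have := sumn_size_le bB; have := sumn_size_le bC.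
have := size_le_sumn a0; have := size_le_sumn b0; have := size_le_sumn c0.
case: a ab a0 bA N => [|p [|p' a]] /= ab; last first.
(* Every tuple has two parts, so excluding E6~ leaves s <= 2, while 2 <= |c| < s. *)
- by move=> /and3P[? ? _] /andP[? _] N; move: (sumn a) => *; lia.
- case: b {b0} bB bc ab qs => [|x [|y [|z b]]] //=.
  + by nia.
  + rewrite !andbT => /andP[Bx By] bc _ qs _ _ N Hc _ _ Rc Rb Ra.
    case: (ltnP (p + 0 + (x + (y + 0)) + sumn c) (2 * s)) => // big.
    (* 2p <= s and 3|b| <= 2s leave |c| >= 5s/6, and |c| <= s k/(k + 1) then needs k >= 5. *)
    have k5 : 5 <= size c by nia.
        have [p3 x2 y2 s6] : [/\ 2 < p, 1 < x, 1 < y & 5 < s].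
      by clear Rc; split; lia.
    by rewrite p3 x2 y2 k5 s6 !orbT in N.
  + move=> _ bc _ qs _ _ N Hc Hb _ Rc Rb Ra.
    have k3 : 2 < size c by lia.
    (* As 2p <= s, p >= 2 would give s >= 4 and hence E7~. With p <= 1 the bounds |b|, |c| <= s - 1
       suffice. *)
    have : p <= 1.
      case: leqP => // p2.
      have s4 : 3 < s by lia.
      by move: N; rewrite p2 k3 s4 /=.
    by lia.
- move=> _ _ _ *; lia.
Qed.

Lemma tame_sum a b c s :
  all (leq 1) a -> all (leq 1) b -> all (leq 1) c -> 0 < s -> tame a b c s ->
  all (fun i => i + sumn a <= s) a -> all (fun i => i + sumn b <= s) b ->
  all (fun i => i + sumn c <= s) c -> sumn a + sumn b + sumn c < 2 * s.
Proof.
wlog ab : a b / size a <= size b.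
  move=> W; case: (leqP (size a) (size b)) => [/W //|/ltnW /W {}W].
  move=> a0 b0 c0 s0; rewrite tameC12 => t bA bB bC.
  by rewrite [sumn a + _]addnC; apply: W.
wlog bc : b c ab / size b <= size c; last first.
  by move=> *; apply: tame_sorted_sum; rewrite ?ab.
move=> W; case: (leqP (size b) (size c)) => [/(W _ _ ab) //|cb].
move=> a0 b0 c0 s0 t bA bB bC.
case: (leqP (size a) (size c)) => ac.
  by rewrite addnAC; apply: W; rewrite // 1?ltnW // tameC23.
rewrite addnAC [sumn a + _]addnC; apply: (@tame_sorted_sum c a b) => //.
  by rewrite ab ltnW.
by rewrite tameC12 tameC23.
Qed.

Definition form_ge1 (a b c : seq nat) (s t : nat) : Prop :=
  2 + 2 * (s * t) <= arm a + arm b + arm c.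

(* Subtracting the unit vector with part [i.+1] of [a] and one unit of [s] changes
   the total by [2 * (i + sumn a - t)]. *)
Lemma part_bound a b c s t u : 0 < s -> all (leq 1) a ->
  arm a + arm b + arm c <= 2 * (s * t) + u -> u <= 2 ->
  (forall a', dom a' a -> (sumn a').+1 = sumn a -> form_ge1 a' b c s.-1 t) ->
  all (fun i => i + sumn a <= t + u.-1) a.
Proof.
move=> s0 a0 f u2 IH; apply/allP => -[|i] ia; first by move/allP: a0 => /(_ _ ia).
move: (IH _ (dom_pred ia) (sumn_pred ia)); rewrite /form_ge1.
have := arm_pred ia.
case: s s0 f {IH} => // s _ f /=; rewrite mulSn in f.
by lia.
Qed.

(** Suppose the form is at most 0. Vectors with one unit less have form at least 1 by induction, so
    [part_bound] with [u = 1], lowering s and then t, bounds each [i + sumn x] by the smaller of the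
    two. Now [tame_sum] contradicts s + t >= 2 min(s, t). *)
Lemma tame_form_ge1 a b c s t : s + t = sumn a + sumn b + sumn c ->
  0 < s + t -> tame a b c (minn s t) -> form_ge1 a b c s t.
Proof.
move En: (s + t) => n; elim: n a b c s t En => // n IH a b c s t st abc _ tm.
rewrite /form_ge1 leqNgt; apply/negP => f.
wlog [a0 b0 c0] : a b c abc tm f / [/\ all (leq 1) a, all (leq 1) b & all (leq 1) c].
  move=> W; apply: (W (pos a) (pos b) (pos c)); rewrite ?sumn_pos ?arm_pos //.
  - by rewrite tame_pos.
  - by rewrite !pos_gt0.
(* Each arm is at least twice its sum, so for [s * t = 0] the form cannot drop below 1. *)
have [s0 t0] : 0 < s /\ 0 < t.
  suff: 0 < s * t by rewrite muln_gt0 => /andP.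
  rewrite lt0n; apply/eqP => st0; rewrite st0 in f.
  have ge x : all (leq 1) x -> sumn x <= ssq x.
    by rewrite /ssq; elim: x => //= i x H /andP[i1 /H]; nia.
  have le x : sumn x <= sumn x ^ 2 by nia.
  move: (ge _ a0) (ge _ b0) (ge _ c0) (le a) (le b) (le c) f abc.
  by rewrite /arm; lia.
case: n IH st abc => [|n] IH st abc; first by lia.
have f1 x y z : arm x + arm y + arm z = arm a + arm b + arm c ->
  arm x + arm y + arm z <= 2 * (s * t) + 1 by lia.
have B x y z : all (leq 1) x -> sumn x + sumn y + sumn z = n.+2 ->
    arm x + arm y + arm z <= 2 * (s * t) + 1 ->
    tame x y z (minn s t) -> all (fun i => i + sumn x <= minn s t) x.
  move=> x0 xyz fx tx.
  have B1 : all (fun i => i + sumn x <= t + 0) x.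
    apply: (part_bound s0 x0 fx) => // a' da sa; apply: IH; try lia.
    apply: tame_mono tx => //; lia.
  have B2 : all (fun i => i + sumn x <= s + 0) x.
    rewrite [s * t]mulnC in fx.
    apply: (part_bound t0 x0 fx) => // a' da sa; rewrite /form_ge1 [t.-1 * s]mulnC.
    apply: IH; try lia.
    apply: tame_mono tx => //; lia.
  apply/allP => i ix; move: (allP B1 _ ix) (allP B2 _ ix) => /=; lia.
have := tame_sum a0 b0 c0 _ tm (B a b c a0 _ _ tm).
have tm2 : tame b a c (minn s t) by rewrite tameC12.
have tm3 : tame c a b (minn s t) by rewrite tameC12 tameC23.
move=> /(_ _ _ _ (B b a c b0 _ _ tm2) (B c a b c0 _ _ tm3)).
lia.
Qed.

(** * Classification of tame vectors with Tits form 1 *)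

(** The tuples omit their last entries, which their sums and s + t determine. They are compared in
    the given order; permuting them is left to [classification]. *)
Definition fits (a b c : seq nat) (s t : nat) (mu : quadruple) : bool :=
  [&& perm_eq (pos a) (pos (chop (qa mu))),
      perm_eq (pos b) (pos (chop (qb mu))),
      perm_eq (pos c) (pos (chop (qc mu))),
      perm_eq [:: s; t] (qd mu)
    & [&& sumn a + last 0 (qa mu) == s + t,
          sumn b + last 0 (qb mu) == s + t
        & sumn c + last 0 (qc mu) == s + t]].

Definition listed (a b c : seq nat) (s t : nat) : Prop :=
  exists2 mu, in_table mu & fits a b c s t mu.

Lemma chop_rcons x i : chop (rcons x i) = x.
Proof. by rewrite /chop size_rcons /= -cats1 take_size_cat. Qed.

Lemma perm_pos x y : perm_eq x y -> perm_eq (pos x) (pos y).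
Proof. exact: perm_filter. Qed.

Lemma fits_perm a b c a' b' c' s t mu :
  perm_eq a a' -> perm_eq b b' -> perm_eq c c' ->
  fits a b c s t mu = fits a' b' c' s t mu.
Proof.
move=> pa pb pc; rewrite /fits.
by rewrite (permPl (perm_pos pa)) (permPl (perm_pos pb)) (permPl (perm_pos pc))
  (perm_sumn pa) (perm_sumn pb) (perm_sumn pc).
Qed.

(* [k] is fuel, bounding the length. *)
Fixpoint parts (k m n : nat) : seq (seq nat) :=
  if k is k'.+1 then
    [::] :: [seq i :: x | i <- iota 1 (minn m n), x <- parts k' i (n - i)]
  else [:: [::]].

Lemma mem_parts k m n x : sorted geq x -> all (leq 1) x -> all (geq m) x ->
  sumn x <= n <= k -> x \in parts k m n.
Proof.
elim: k m n x => [|k IH] m n [|i x] //=; first by move=> _ /andP[? _] _ ?; lia.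
move=> ix /andP[i1 x1] /andP[im xm] /andP[sx nk].
rewrite inE; apply/orP; right; apply/allpairsPdep; exists i, x; split=> //.
  by rewrite mem_iota; lia.
have tr : transitive geq by move=> u v w /= *; lia.
apply: IH => //; [exact: path_sorted ix | exact: order_path_min ix | by lia].
Qed.

(** The ranges [iota 4 5] and [iota 3 2] reach every member of the series with min(d_1, d_2) <=
    8. *)
Definition small_table : seq quadruple :=
  special_cases ++
  flatten [seq [:: ([:: 1; 2 * k - 1], rcons (nseq (k - 1) 1) (k + 1),
                    rcons (nseq k 1) k, [:: k; k]);
                   ([:: 1; 2 * k], rcons (nseq k 1) (k + 1),
                    rcons (nseq k 1) (k + 1), [:: k; k + 1])] | k <- iota 4 5] ++
  flatten [seq [:: ([:: m; 3 * m], [:: 1; m - 1; 3 * m],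
                    rcons (nseq (2 * m) 1) (2 * m), [:: 2 * m; 2 * m]);
                   ([:: m; 3 * m], [:: 1; m; 3 * m - 1],
                    rcons (nseq (2 * m - 1) 1) (2 * m + 1), [:: 2 * m; 2 * m]);
                   ([:: m; 3 * m + 2], [:: 1; m; 3 * m + 1],
                    rcons (nseq (2 * m + 1) 1) (2 * m + 1),
                    [:: 2 * m + 1; 2 * m + 1]);
                   ([:: m + 1; 3 * m + 1], [:: 1; m; 3 * m + 1],
                    rcons (nseq (2 * m) 1) (2 * m + 2),
                    [:: 2 * m + 1; 2 * m + 1]);
                   ([:: m; 3 * m + 1], [:: 1; m; 3 * m],
                    rcons (nseq (2 * m) 1) (2 * m + 1), [:: 2 * m; 2 * m + 1]);
                   ([:: m + 1; 3 * m + 2], [:: 1; m; 3 * m + 2],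
                    rcons (nseq (2 * m + 1) 1) (2 * m + 2),
                    [:: 2 * m + 1; 2 * m + 2])] | m <- iota 3 2].

Lemma small_table_in mu : mu \in small_table -> in_table mu.
Proof.
rewrite mem_cat => /orP[?|]; first by left.
rewrite mem_cat => /orP[] /flatten_mapP[k]; rewrite mem_iota => /andP[k4 _];
  rewrite !inE => H; right; repeat (case/orP: H => H); rewrite (eqP H);
  by constructor.
Qed.

(** Nested conditionals keep call-by-value evaluation from testing [tame] and searching the table
    unless the two numerical equations hold. *)
Definition classified (s t : nat) : bool :=
  let P := [seq x <- parts s s s | all (fun i => i + sumn x <= s.+1) x] in
  all (fun a => all (fun b => if size a <= size b then all (fun c =>
    if sumn a + sumn b + sumn c == s + t then
      if arm a + arm b + arm c == 2 + 2 * (s * t) then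
        if size b <= size c then
          if tame a b c s then has (fits a b c s t) small_table else true
        else true
      else true
    else true) P else true) P) P.

Lemma small_classified :
  all (fun s => all (classified s) (iota s 3)) (iota 1 8).
Proof. by vm_compute. Qed.

Lemma sort_perm x : perm_eq x (sort geq x).
Proof. by rewrite perm_sym perm_sort. Qed.

Lemma listed_small a b c s t : 0 < s <= 8 -> s <= t <= s + 2 ->
  all (leq 1) a -> all (leq 1) b -> all (leq 1) c ->
  size a <= size b <= size c -> tame a b c s ->
  all (fun i => i + sumn a <= s.+1) a -> all (fun i => i + sumn b <= s.+1) b ->
  all (fun i => i + sumn c <= s.+1) c -> sumn a + sumn b + sumn c = s + t ->
  arm a + arm b + arm c = 2 + 2 * (s * t) -> listed a b c s t.
Proof.
move=> s8 st a0 b0 c0 sz tm bA bB bC abc f.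
have sP x : all (leq 1) x -> all (fun i => i + sumn x <= s.+1) x ->
    sort geq x \in [seq x <- parts s s s | all (fun i => i + sumn x <= s.+1) x].
  move=> x0 bx; have xs := sumn_lt (ltn0Sn s) bx.
  have sE := perm_sumn (sort_perm x).
  rewrite mem_filter -sE (perm_all _ (permEl (perm_sort geq x))) bx /=.
  apply: mem_parts; rewrite ?(perm_all _ (permEl (perm_sort geq x))) //.
  - by apply: sort_sorted => i j /=; apply: leq_total.
  - apply/allP=> i ix /=; apply: (@leq_trans (sumn x)); last by rewrite -ltnS.
    by rewrite (perm_sumn (perm_to_rem ix)) /= leq_addr.
  - by rewrite -sE; lia.
have /allP/(_ s) := small_classified.
rewrite mem_iota => /(_ ltac:(lia)) /allP/(_ t); rewrite mem_iota.
move=> /(_ ltac:(lia)) /allP/(_ _ (sP _ a0 bA)) /allP/(_ _ (sP _ b0 bB)).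
case/andP: sz => ab bc; rewrite !size_sort ab => /allP/(_ _ (sP _ c0 bC)).
rewrite !size_sort bc -!(perm_sumn (sort_perm _)) -!(perm_arm (sort_perm _)).
rewrite abc f !eqxx.
have -> : tame (sort geq a) (sort geq b) (sort geq c) s = tame a b c s.
  by rewrite /tame /null !count_sort.
rewrite tm => /hasP[mu /small_table_in mu_in fmu]; exists mu => //.
by rewrite (fits_perm _ _ _ (sort_perm a) (sort_perm b) (sort_perm c)).
Qed.

(** * Large vectors and the infinite series *)

Lemma all1_nseq x : all (leq 1) x -> ssq x <= sumn x -> x = nseq (sumn x) 1.
Proof.
rewrite /ssq; elim: x => //= i x IH /andP[i1 /[dup] x1 /IH {}IH] h.
have : sumn x <= sumn [seq j ^ 2 | j <- x].
  by elim: x x1 {IH h} => //= j x H /andP[? /H]; nia.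
move=> h'; have i_1 : i = 1 by nia.
by rewrite i_1 add1n /= -IH //; nia.
Qed.

Lemma ssq_ge x : sumn x <= ssq x.
Proof. by rewrite /ssq; elim: x => //= i x; nia. Qed.

(** [i + s <= s + 1] forces every part to be 1. *)
Lemma ones_eq x s : all (leq 1) x -> sumn x = s ->
  all (fun i => i + sumn x <= s.+1) x -> x = nseq s 1.
Proof. by move=> x0 xs /ssq_le h; rewrite -xs; apply: all1_nseq => //; nia. Qed.

(** The bounds give p + y <= s, hence t <= |c| + 1 <= s + 1. One unit of slack leaves three cases: t
    = s + 1, or t = s with |c| = s or |c| = s - 1. Each splits by the parity of s into one of the
    six series with parameter m. The bounds or the form fix p and y and make c all ones. *)
Lemma listed_pair p y c s t : 8 < s -> s <= t <= s + 2 -> 2 * p <= s + 1 ->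
  2 * y <= s -> all (leq 1) c -> all (fun i => i + sumn c <= s.+1) c ->
  p + (1 + y) + sumn c = s + t ->
  2 * p ^ 2 + (1 + y ^ 2 + (1 + y) ^ 2) + arm c = 2 + 2 * (s * t) ->
  listed [:: p] [:: 1; y] c s t.
Proof.
move=> s8 st p2 y2 c0 bC pyc; have rs := sumn_lt (ltn0Sn s) bC.
case: (ltngtP t s) => [|ts|tE]; first by lia.
  have rE : sumn c = s by lia.
  rewrite (ones_eq c0 rE bC) => _.
  have tE : t = s + 1 by lia.
  have sE := odd_double_half s; set m := s./2 in sE; rewrite -mul2n in sE.
  case: (odd s) sE => /= sE.
    have [pE yE] : p = m + 1 /\ y = m by lia.
    exists ([:: m + 1; 3 * m + 2], [:: 1; m; 3 * m + 2],
      rcons (nseq (2 * m + 1) 1) (2 * m + 2), [:: 2 * m + 1; 2 * m + 2]).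
      by right; constructor; lia.
    have -> : s = 2 * m + 1 by lia.
    have -> : t = 2 * m + 2 by lia.
    rewrite pE yE /fits /qa /qb /qc /qd /= chop_rcons last_rcons.
    by rewrite !perm_refl sumn_nseq /=; lia.
  have [pE yE] : p = m /\ y = m by lia.
  exists ([:: m; 3 * m + 1], [:: 1; m; 3 * m],
     rcons (nseq (2 * m) 1) (2 * m + 1), [:: 2 * m; 2 * m + 1]).
    by right; constructor; lia.
  have -> : s = 2 * m by lia.
  have -> : t = 2 * m + 1 by lia.
  rewrite pE yE /fits /qa /qb /qc /qd /= chop_rcons last_rcons.
  by rewrite !perm_refl sumn_nseq /=; lia.
rewrite {}tE in st pyc *.
have sE := odd_double_half s; set m := s./2 in sE; rewrite -mul2n in sE.
case: (ltngtP (sumn c) s) => [rE f||rE]; last 1 first.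
- rewrite (ones_eq c0 rE bC) {1}/arm /ssq map_nseq !sumn_nseq !mul1n => f.
  case: (odd s) sE => /= sE.
    have [pE yE] : p = m /\ y = m.
      (* The candidates for (p, y) are (m, m) and (m + 1, m - 1); the form rejects the second. *)
      have : y = m \/ y = m - 1 by lia.
      by case=> yE; [lia | have pE : p = m + 1 by lia]; exfalso;
        rewrite -sE pE yE in f; nia.
    exists ([:: m; 3 * m + 2], [:: 1; m; 3 * m + 1],
      rcons (nseq (2 * m + 1) 1) (2 * m + 1), [:: 2 * m + 1; 2 * m + 1]).
      by right; constructor; lia.
    have -> : s = 2 * m + 1 by lia.
    rewrite pE yE /fits /qa /qb /qc /qd /= chop_rcons last_rcons.
    by rewrite !perm_refl sumn_nseq /=; lia.
  have [pE yE] : p = m /\ y = m - 1.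
    have : y = m \/ y = m - 1 by lia.
    by case=> yE; [have pE : p = m - 1 by lia | lia]; exfalso;
      rewrite -sE pE yE in f; nia.
  exists ([:: m; 3 * m], [:: 1; m - 1; 3 * m],
    rcons (nseq (2 * m) 1) (2 * m), [:: 2 * m; 2 * m]).
    by right; constructor; lia.
  have -> : s = 2 * m by lia.
  rewrite pE yE /fits /qa /qb /qc /qd /= chop_rcons last_rcons.
  by rewrite !perm_refl sumn_nseq /=; lia.
- have {}rE : sumn c = s - 1 by lia.
  have cE : ssq c <= sumn c -> c = nseq (s - 1) 1.
    by move=> h; rewrite -rE; apply: all1_nseq.
  rewrite /arm rE in f *; move: (ssq c) f cE => Q f cE.
  case: (odd s) sE => /= sE.
    have [pE yE] : p = m + 1 /\ y = m by lia.
    rewrite cE; last by rewrite -sE pE yE in f *; nia.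
    exists ([:: m + 1; 3 * m + 1], [:: 1; m; 3 * m + 1],
      rcons (nseq (2 * m) 1) (2 * m + 2), [:: 2 * m + 1; 2 * m + 1]).
      by right; constructor; lia.
    have -> : s = 2 * m + 1 by lia.
    rewrite pE yE addnK /fits /qa /qb /qc /qd /= chop_rcons last_rcons.
    by rewrite !perm_refl sumn_nseq /=; lia.
  have [pE yE] : p = m /\ y = m by lia.
  rewrite cE; last by rewrite -sE pE yE in f *; nia.
  exists ([:: m; 3 * m], [:: 1; m; 3 * m - 1],
    rcons (nseq (2 * m - 1) 1) (2 * m + 1), [:: 2 * m; 2 * m]).
    by right; constructor; lia.
  have -> : s = 2 * m by lia.
  rewrite pE yE /fits /qa /qb /qc /qd /= chop_rcons last_rcons.
  by rewrite !perm_refl sumn_nseq /=; lia.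
- by lia.
Qed.

Lemma sq_add_le x y : (x + y) ^ 2 <= 2 * x ^ 2 + 2 * y ^ 2.
Proof. by have := leq_of_leqif (nat_Cauchy x y); rewrite sqrnD; lia. Qed.

(* Weighted Cauchy-Schwarz with 1/2 + 2/3 + 4/5 = 59/30; the gap between 59/30
   and 2 is what bounds [s]. *)
Lemma weighted_cauchy p q r :
  120 * (p + q + r) ^ 2 <= 59 * (8 * p ^ 2 + 6 * q ^ 2 + 5 * r ^ 2).
Proof.
have := leq_of_leqif (nat_Cauchy (4 * p) (3 * q));
  have := leq_of_leqif (nat_Cauchy (8 * p) (5 * r)).
by have := leq_of_leqif (nat_Cauchy (6 * q) (5 * r)); rewrite -!mulnn; lia.
Qed.

(** The hypotheses on P, Q, R are Cauchy-Schwarz for at most 1, 2 and 4 parts, so the form equation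
    has left side at least 2p^2 + 3q^2/2 + 5r^2/4. Against 2st <= (s + t)^2/2 this leaves (s + t)^2
    <= 236 < 16^2. *)
Lemma form_bound p q r P Q R s t : p + q + r = s + t ->
  p ^ 2 <= P -> q ^ 2 <= 2 * Q -> r ^ 2 <= 4 * R ->
  P + p ^ 2 + (Q + q ^ 2) + (R + r ^ 2) = 2 + 2 * (s * t) -> s + t <= 15.
Proof.
move=> e hP hQ hR f; have := weighted_cauchy p q r; rewrite e.
have := leq_of_leqif (nat_Cauchy s t); rewrite sqrnD => h1 h2.
have : (s + t) ^ 2 < 16 ^ 2 by rewrite sqrnD; lia.
by rewrite ltn_sqr; lia.
Qed.

Lemma listed_large a b c s t : 8 < s -> s <= t <= s + 2 ->
  all (leq 1) a -> all (leq 1) b -> all (leq 1) c ->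
  size a <= size b <= size c -> tame a b c s ->
  all (fun i => i + sumn a <= s.+1) a -> all (fun i => i + sumn b <= s.+1) b ->
  all (fun i => i + sumn c <= s.+1) c -> sumn a + sumn b + sumn c = s + t ->
  arm a + arm b + arm c = 2 + 2 * (s * t) -> listed a b c s t.
Proof.
move=> s8 st a0 b0 c0 /andP[ab bc].
rewrite /tame negb_or => /andP[+ _]; rewrite /null !count_ge1 //.
move=> N bA bB bC abc.
have qs := sumn_lt (ltn0Sn s) bB; have rs := sumn_lt (ltn0Sn s) bC.
have sc := ssq_le bC; have gc := ssq_ge c.
have sb := ssq_le bB; have gb := ssq_ge b.
case: a ab a0 bA N abc => [|p [|p' a]] /= ab a0 bA N abc; last first.
(* Two parts in every tuple: this is E6~. *)
- have b2 : 1 < size b by apply: leq_trans ab.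
  have s3 : 2 < s by apply: leq_trans s8.
  by move: N; rewrite b2 (leq_trans b2 bc) s3.
- case: (leqP p 1) => p1.
    have {p1 a0 bA N} p1 : p = 1 by lia.
    rewrite {}p1 in ab abc *; rewrite {1}/arm /ssq /= => f.
    case: (leqP t s) => ts.
      have tE : t = s by lia.
      rewrite {}tE in st abc f *.
      (* |b| + |c| = 2s - 1, so one sum is s. If it were |b|, then b would be s ones, and c, having
         no fewer parts, would also have sum at least s. *)
      have rE : sumn c = s.
        case: (ltngtP (sumn c) s) => // h; last by lia.
        have bq : sumn b = s by lia.
        have : ssq b <= sumn b by rewrite bq in sb *; nia.
        move/(all1_nseq b0) => bE.
        have := size_le_sumn c0; move: bc; rewrite {1}bE size_nseq; lia.
      have cE : c = nseq s 1.
        by rewrite -[in RHS]rE; apply: all1_nseq => //; rewrite rE in sc *; nia.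
      have qE : sumn b = s - 1 by lia.
      have bE : b = nseq (s - 1) 1.
        rewrite -[in RHS]qE; apply: all1_nseq => //.
        rewrite /arm rE qE in f *; rewrite cE in f.
        have : ssq (nseq s 1) = s by rewrite /ssq map_nseq sumn_nseq mul1n.
        move: (ssq b) f => B f h; rewrite h in f; clear -f s8; nia.
      have lb : 4 <= s by lia.
      exists ([:: 1; 2 * s - 1], rcons (nseq (s - 1) 1) (s + 1),
        rcons (nseq s 1) s, [:: s; s]); first by right; constructor.
      rewrite /fits /qa /qb /qc /qd /= !chop_rcons !last_rcons bE cE.
      rewrite !perm_refl !sumn_nseq /=; lia.
    have tE : t = s + 1 by lia.
    have [bE cE] : b = nseq s 1 /\ c = nseq s 1.
      by split; apply: ones_eq => //; lia.
    rewrite bE cE tE.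
    exists ([:: 1; 2 * s], rcons (nseq s 1) (s + 1), rcons (nseq s 1) (s + 1),
      [:: s; s + 1]); first by right; constructor; lia.
    rewrite /fits /qa /qb /qc /qd /= !chop_rcons !last_rcons.
    by rewrite !perm_refl !sumn_nseq /=; lia.
  have p2 : 2 * p <= s.+1 by case/andP: bA; lia.
  rewrite {1}/arm /ssq /= => f.
  case: b b0 bB ab bc abc qs sb gb N f => [|x [|y [|z b]]] //= b0 bB _ bc abc.
  + move=> _ _ _ _ f.
    have q2 : 2 * x <= s.+1 by case/andP: bB; lia.
    rewrite addn0 in abc f.
    have c5 : p + (x + 0) + sumn c = s + t by lia.
    clear -f abc gc rs p2 q2 st s8.
    exfalso; rewrite /arm /ssq /= in f gc.
    move: (sumn [seq i ^ 2 | i <- c]) (sumn c) => Q r in f gc rs abc.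
    (* The two one-part arms total 2p^2 + 2x^2 >= (p + x)^2, which together with [arm c] >= r + r^2
       exceeds form 1 in all three cases. *)
    have h := sq_add_le p x.
    have [[rE tE]|[[rE tE]|[rE tE]]] :
      (r = s /\ t = s + 1) \/ (r = s /\ t = s) \/ (r = s - 1 /\ t = s) by lia.
    * have e : p + x = s + 1 by lia.
      rewrite rE tE e -!mulnn in f h gc; lia.
    * have e : p + x = s by lia.
      rewrite rE tE e -!mulnn in f h gc; lia.
    * have e : p + x = s + 1 by lia.
      rewrite rE tE e -!mulnn in f h gc; lia.
  + move=> qs sb gb N f.
    (* With at most four parts in c, [form_bound] gives s + t <= 15, against s > 8. *)
    case: (ltnP 4 (size c)) => c5; last first.
      have := cauchy_ssq c => cc.
      have := @form_bound p (x + (y + 0)) (sumn c) (p ^ 2) (x ^ 2 + y ^ 2)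
        (ssq c) s t.
      move=> /(_ _ _ _ _ _) h.
      have : s + t <= 15.
        apply: h; [lia | done | | | ].
        - by have := sq_add_le x y; rewrite addn0; lia.
        - by apply: leq_trans cc _; rewrite leq_mul2r c5 orbT.
        - by move: f; rewrite /arm /ssq /= !addn0; lia.
      by clear -s8 st; lia.
    have [xb yb] : 2 * x + y <= s.+1 /\ x + 2 * y <= s.+1.
      by case/and3P: bB => *; lia.
    have p3 : 2 < p by clear -abc rs s8 st p1 xb yb; lia.
    have s6 : 5 < s by apply: leq_trans s8.
    have [x1 y1] : 1 <= x /\ 1 <= y by case/and3P: b0.
    (* p >= 3 and five parts in c: x, y >= 2 would give E8~. *)
    have : (x <= 1) || (y <= 1).
      case: (leqP x 1) => //= x2; case: (leqP y 1) => //= y2.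
      by move: N; rewrite p3 x2 y2 c5 s6 !orbT.
    have pos1 (u v : nat) : perm_eq [:: u; v] [:: v; u].
      by have /= -> := perm_catC [:: u] [:: v] [:: v; u].
    case/orP=> h.
      have xE : x = 1 by lia.
      rewrite xE in yb f abc *; move: f; rewrite {1}/arm /ssq /= !addn0 => f.
      by apply: listed_pair; first [done | lia].
    have yE : y = 1 by lia.
    rewrite yE in xb f abc *.
    have [mu ? ?] : listed [:: p] [:: 1; x] c s t.
      move: f; rewrite {1}/arm /ssq /= !addn0 => f.
      by apply: listed_pair; first [done | lia].
    exists mu => //; rewrite (fits_perm _ _ _ (perm_refl _) (pos1 x 1) (perm_refl _)).
    by [].
  (* p >= 2 with three parts in both b and c: this is E7~. *)
  + move=> _ _ _ N _.
    have s4 : 3 < s by apply: leq_trans s8.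
    have c3 : 2 < size c by apply: leq_trans bc.
    by move: N; rewrite p1 c3 s4.
(* With a empty, b and c both consist of s ones and t = s; the form equation then reads s = 1. *)
- move=> f.
  have rE : sumn c = s by lia.
  have tE : t = s by lia.
  have bE := ones_eq b0 (_ : sumn b = s) bB.
  have cE := ones_eq c0 rE bC.
  move: f; rewrite tE cE bE; last by lia.
  rewrite /arm /ssq !map_nseq !sumn_nseq /= !mul1n.
  by clear -s8; nia.
Qed.

Lemma listed_one a b c s t : all (leq 1) a -> all (leq 1) b -> all (leq 1) c ->
  size a <= size b <= size c -> s <= t -> s + t = 1 ->
  sumn a + sumn b + sumn c = 1 -> listed a b c s t.
Proof.
move=> a0 b0 c0 sz st st1 abc.
have [-> ->] : s = 0 /\ t = 1 by lia.
move: (size_le_sumn a0) (size_le_sumn b0) (size_le_sumn c0).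
case: a b c a0 b0 c0 sz abc => [|x a] [|y b] [|z [|z' c]] //=; try lia.
move=> _ _ _ _ z1 _ _ _; have {z1}-> : z = 1 by lia.
by exists ([:: 1], [:: 1], [:: 1; 0], [:: 0; 1]); first by left.
Qed.

(** The second hypothesis rearranges to (s - 1) t <= (s - 1)(s + 2). *)
Lemma le_add2_of_form s t :
  1 < s -> 2 + 2 * (s * t) <= s.+1 * (s + t) -> t <= s + 2.
Proof.
move=> s1; case: (leqP t (s + 2)) => // /subnKC <-; move: (t - _) => k.
by case: s s1 => [|[|j]] // _; rewrite !(mulnDr, mulnDl, mulSn, mulnS); lia.
Qed.

Lemma listed_sorted a b c s t :
  all (leq 1) a -> all (leq 1) b -> all (leq 1) c ->
  size a <= size b <= size c -> s <= t -> 0 < s + t ->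
  sumn a + sumn b + sumn c = s + t -> tame a b c s ->
  arm a + arm b + arm c = 2 + 2 * (s * t) -> listed a b c s t.
Proof.
move=> a0 b0 c0 sz st st0 abc tm f.
have [st1|n1] := eqVneq (s + t) 1; first by apply: listed_one => //; lia.
(* Lowering the larger entry t, with [u = 2], yields the bound in terms of the smaller entry s. *)
have B x y z : all (leq 1) x -> sumn x + sumn y + sumn z = s + t ->
    arm x + arm y + arm z <= 2 * (s * t) + 2 -> tame x y z s ->
    all (fun i => i + sumn x <= s.+1) x.
  move=> x0 xyz fx tx; rewrite [s * t]mulnC in fx.
  have t0 : 0 < t by lia.
  rewrite -addn1; apply: (part_bound t0 x0 fx) => // a' da sa.
  rewrite /form_ge1 [t.-1 * s]mulnC; apply: tame_form_ge1; try lia.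
  by apply: tame_mono tx => //; lia.
have bA : all (fun i => i + sumn a <= s.+1) a by apply: (B a b c) => //; lia.
have bB : all (fun i => i + sumn b <= s.+1) b.
  by apply: (B b a c) => //; [lia | lia | rewrite tameC12].
have bC : all (fun i => i + sumn c <= s.+1) c.
  by apply: (B c a b) => //; [lia | lia | rewrite tameC12 tameC23].
have s0 : 0 < s.
  have := sumn_lt (ltn0Sn s) bA; have := sumn_lt (ltn0Sn s) bB.
  by have := sumn_lt (ltn0Sn s) bC; lia.
(* Weighting by the parts gives [arm x <= s.+1 * sumn x], and the three sum to 2 + 2st <= (s + 1)(s
   + t). For s = 1 the bound |x| <= s on each tuple is enough. *)
have ts : t <= s + 2.
  case: (ltnP 1 s) => s1.
    move: (ssq_le bA) (ssq_le bB) (ssq_le bC) f; rewrite /arm -!mulnn => hA hB hC f.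
    have : 2 + 2 * (s * t) <= s.+1 * (s + t) by rewrite -abc !mulnDr; lia.
    exact: le_add2_of_form.
  have := sumn_lt (ltn0Sn s) bA; have := sumn_lt (ltn0Sn s) bB.
  by have := sumn_lt (ltn0Sn s) bC; lia.
case: (leqP s 8) => s8; [apply: listed_small | apply: listed_large] => //; lia.
Qed.

Lemma fitsC a b c s t mu : fits a b c s t mu = fits a b c t s mu.
Proof.
rewrite /fits [t + s]addnC; congr [&& _, _, _, _ & _].
by have /= -> := perm_catC [:: s] [:: t] (qd mu).
Qed.

Lemma pos_pos x : pos (pos x) = pos x.
Proof. by apply/all_filterP/allP => i; rewrite mem_filter => /andP[]. Qed.

Lemma classification a b c s t : 0 < s + t ->
  sumn a + sumn b + sumn c = s + t -> tame a b c (minn s t) ->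
  arm a + arm b + arm c = 2 + 2 * (s * t) ->
  exists x y z, perm_eq [:: a; b; c] [:: x; y; z] /\ listed x y z s t.
Proof.
wlog st : s t / s <= t.
  move=> W; case/orP: (leq_total s t) => [/W //|/W W'].
  rewrite [s + t]addnC minnC [s * t]mulnC => t0 abc tm f.
  have [x [y [z [p [mu ? h]]]]] := W' t0 abc tm f.
  by exists x, y, z; split=> //; exists mu; rewrite // fitsC.
rewrite (minn_idPl st) => st0.
pose P (a b c : seq nat) := exists x y z : seq nat,
  perm_eq [:: a; b; c] [:: x; y; z] /\ listed x y z s t.
have sw (u v w : seq nat) : perm_eq [:: u; v; w] [:: v; u; w].
  by rewrite -[_ :: _ :: _]/([:: u; v] ++ [:: w])
    -[X in perm_eq _ X]/([:: v; u] ++ [:: w]) perm_cat2r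
    (perm_catC [:: u] [:: v] [:: v; u]).
have sw2 (u v w : seq nat) : perm_eq [:: u; v; w] [:: u; w; v].
  by rewrite perm_cons (perm_catC [:: v] [:: w] [:: w; v]).
have P12 u v w : P u v w -> P v u w.
  move=> [x [y [z [p l]]]]; exists x, y, z; split=> //.
  by apply: perm_trans p; apply: sw.
have P23 u v w : P u v w -> P u w v.
  move=> [x [y [z [p l]]]]; exists x, y, z; split=> //.
  by apply: perm_trans p; apply: sw2.
rewrite -/(P a b c).
have S u v w : size (pos u) <= size (pos v) <= size (pos w) ->
    sumn u + sumn v + sumn w = s + t -> tame u v w s ->
    arm u + arm v + arm w = 2 + 2 * (s * t) -> P u v w.
  move=> sz uvw tm f; exists u, v, w; split=> //.
  have [mu mu_in fm] : listed (pos u) (pos v) (pos w) s t.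
    by apply: listed_sorted; rewrite ?pos_gt0 ?sumn_pos ?arm_pos ?tame_pos.
  by exists mu => //; move: fm; rewrite /fits !pos_pos !sumn_pos.
wlog ab : a b / size (pos a) <= size (pos b).
  move=> W; case: (leqP (size (pos a)) (size (pos b))) => [/W //|/ltnW /W {}W].
  rewrite [sumn a + _]addnC [arm a + _]addnC tameC12 => h1 h2 h3.
  exact/P12/W.
move=> h1 h2 h3.
case: (leqP (size (pos b)) (size (pos c))) => bc; first by apply: S; rewrite ?ab.
case: (leqP (size (pos a)) (size (pos c))) => ac.
  apply/P23/S; [by rewrite ac ltnW | by rewrite addnAC | by rewrite tameC23 |].
  by rewrite addnAC.
apply/P23/P12/S; [by rewrite ab ltnW | by rewrite -h1; lia | | by rewrite -h3; lia].
by rewrite tameC12 tameC23.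
Qed.

(** * From truncated tuples back to quadruples *)

Lemma rcons_chop x : 0 < size x -> x = rcons (chop x) (last 0 x).
Proof. by case/lastP: x => // x i _; rewrite chop_rcons last_rcons. Qed.

Lemma sumn_chop x : sumn x = sumn (chop x) + last 0 x.
Proof. by case/lastP: x => // x i; rewrite chop_rcons last_rcons sumn_rcons. Qed.

Lemma ssq_chop x : ssq x = ssq (chop x) + last 0 x ^ 2.
Proof.
case/lastP: x => // x i; rewrite chop_rcons last_rcons.
by rewrite /ssq map_rcons sumn_rcons.
Qed.

Definition qssq (lam : quadruple) : nat :=
  ssq (qa lam) + ssq (qb lam) + ssq (qc lam) + ssq (qd lam).

Lemma sqsumE x : sqsum x = ((ssq x)%:R)%R.
Proof.
rewrite /sqsum /ssq sumnE big_map natr_sum.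
by apply: eq_bigr => i _; rewrite -[LHS]natrX.
Qed.

Lemma tits1E lam : tits lam = 1%R <-> qssq lam = 2 + 2 * qsize lam ^ 2.
Proof.
rewrite /tits !sqsumE /qssq; split=> [h|h].
  have {}h : ((qssq lam)%:R = (2 + 2 * qsize lam ^ 2)%:R :> rat)%R.
    move: h => /(congr1 (fun x : rat => (x * 2 + 2 * (qsize lam)%:R ^+ 2)%R)).
    rewrite divfK // subrK mul1r => h.
    by rewrite [RHS]natrD [(2 * _)%:R%R]natrM natrX -h -!natrD.
  by move/eqP: h; rewrite Num.Theory.eqr_nat => /eqP.
rewrite -!natrD h natrD [(2 * _)%:R%R]natrM natrX addrK.
by rewrite divff.
Qed.

Lemma sim_tuple_eq x y : sim_tuple x y ->
  [/\ ssq x = ssq y & sumn (chop x) = sumn (chop y)].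
Proof.
case/andP=> /eqP l p; rewrite (ssq_chop x) (ssq_chop y) l.
rewrite -(ssq_pos (chop x)) -(sumn_pos (chop x)).
by rewrite (perm_ssq p) (perm_sumn p) ssq_pos sumn_pos.
Qed.

Lemma sim_quadruple_eq lam mu : sim_quadruple lam mu ->
  qssq lam = qssq mu /\ qsize lam = qsize mu.
Proof.
case=> x [y [z [p sx sy sz pd]]].
have E f : f (qa lam) + f (qb lam) + f (qc lam) = f x + f y + f z :> nat.
  by have := perm_sumn (perm_map f p); rewrite /= !addn0 !addnA.
rewrite /qssq /qsize (E ssq) (E (fun u => sumn (chop u))) (perm_ssq pd).
by case: (sim_tuple_eq sx) (sim_tuple_eq sy) (sim_tuple_eq sz)
  => -> -> [-> ->] [-> ->].
Qed.

Lemma ssq_ones k i : ssq (rcons (nseq k 1) i) = k + i ^ 2.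
Proof. by rewrite /ssq map_rcons sumn_rcons map_nseq sumn_nseq mul1n. Qed.

Lemma in_table_tits mu : in_table mu -> qssq mu = 2 + 2 * qsize mu ^ 2.
Proof.
case=> [|[]].
  have /allP h : all (fun mu => qssq mu == 2 + 2 * qsize mu ^ 2) special_cases.
    by vm_compute.
  by move/h/eqP.
all: move=> k k3; rewrite /qssq /qsize /qa /qb /qc /qd /= ?ssq_ones ?chop_rcons.
all: rewrite ?sumn_nseq /chop /ssq /=.
(* Every series has parameter at least 3; writing it as j + 3 removes the truncated subtractions. *)
all: have [j ->] : exists j, k = j.+3 by exists (k - 3); lia.
all: rewrite -!mulnn; nia.
Qed.

Lemma chopped_form p q r P Q R x y z s t : p + q + r = s + t ->
  P + x ^ 2 + (Q + y ^ 2) + (R + z ^ 2) + (s ^ 2 + (t ^ 2 + 0)) =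
    2 + 2 * (s + t) ^ 2 ->
  p + x = s + t -> q + y = s + t -> r + z = s + t ->
  P + p ^ 2 + (Q + q ^ 2) + (R + r ^ 2) = 2 + 2 * (s * t).
Proof.
move=> n f xE yE zE.
have [px qy rz] : [/\ p * x + p ^ 2 = p * (s + t), q * y + q ^ 2 = q * (s + t)
                    & r * z + r ^ 2 = r * (s + t)].
  by rewrite -{1}xE -{1}yE -{1}zE; split; nia.
have e : p * (s + t) + q * (s + t) + r * (s + t) = (s + t) ^ 2.
  by rewrite -!mulnDl n mulnn.
have [xx yy zz] : [/\ (p + x) ^ 2 = (s + t) ^ 2, (q + y) ^ 2 = (s + t) ^ 2
                    & (r + z) ^ 2 = (s + t) ^ 2] by rewrite xE yE zE.
by move: xx yy zz; rewrite !sqrnD in f e *; lia.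
Qed.

Lemma tame_tits1 (lam : quadruple) l1 l2 l3 (l1_gt0 : 1 <= l1) (l2_gt0 : 1 <= l2)
    (l3_gt0 : 1 <= l3) (lamP : Lambda l1 l2 l3 2 lam) (lam_ge1 : 1 <= qsize lam) :
  tame (chop (qa lam)) (chop (qb lam)) (chop (qc lam))
    (minn (nth 0 (qd lam) 0) (nth 0 (qd lam) 1)) ->
  tits lam = 1%R <-> exists2 mu : quadruple, in_table mu & sim_quadruple lam mu.
Proof.
move=> tm; rewrite tits1E; split; last first.
  by case=> mu /in_table_tits mu1 /sim_quadruple_eq[-> ->].
case: lamP => -[sa sb sc sd] _ [na nb nc nd].
move: tm sd nd; case qdE : (qd lam) => [|s [|t []]] //= tm _ nd f.
rewrite addn0 in nd.
have abc : sumn (chop (qa lam)) + sumn (chop (qb lam)) + sumn (chop (qc lam)) =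
  s + t by rewrite nd.
have st0 : 0 < s + t by rewrite nd.
have g : arm (chop (qa lam)) + arm (chop (qb lam)) + arm (chop (qc lam)) =
    2 + 2 * (s * t).
  move: f na nb nc; rewrite /qssq qdE (ssq_chop (qa lam)) (ssq_chop (qb lam)).
  rewrite (ssq_chop (qc lam)) -nd {4}/ssq /= (sumn_chop (qa lam)).
  rewrite (sumn_chop (qb lam)) (sumn_chop (qc lam)).
  by apply: chopped_form; rewrite nd.
have [x [y [z [p [mu mu_in]]]]] := classification st0 abc tm g.
case/and5P=> px py pz pd /and3P[/eqP lx /eqP ly /eqP lz].
exists mu => //.
have S u n : 0 < size u -> sumn u = n -> rcons (chop u) (n - sumn (chop u)) = u.
  by move=> u0 <-; rewrite {1}(sumn_chop u) addKn -rcons_chop.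
(* The permuted truncated tuples regain their last entries as complements to n = s + t. *)
exists (rcons x (s + t - sumn x)), (rcons y (s + t - sumn y)),
  (rcons z (s + t - sumn z)); split.
- have := perm_map (fun u => rcons u (s + t - sumn u)) p.
  by rewrite /= nd !S ?sa ?sb ?sc.
- by rewrite /sim_tuple last_rcons chop_rcons -lx addKn eqxx.
- by rewrite /sim_tuple last_rcons chop_rcons -ly addKn eqxx.
- by rewrite /sim_tuple last_rcons chop_rcons -lz addKn eqxx.
- by rewrite qdE.
Qed.

(** * Isomorphisms of extended configurations *)

Section Restriction.

Local Open Scope ring_scope.
Variable K : fieldType.

Definition one_arm N (ar : nat -> nat) (v : 'I_N -> K) : Prop :=
  forall i j : 'I_N, v i != 0 -> v j != 0 -> ar i = ar j.

(** U, the column space of B, meets each arm in 0 and projects onto each arm. So a coordinate line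
    inside U has no nonzero morphism to the configuration, and the configuration has none to a
    coordinate line meeting U in 0. *)
Definition generic N s (ar : nat -> nat) (B : 'M[K]_(N, s)) : Prop :=
  (forall w : 'cV_s, one_arm ar (fun i => (B *m w) i 0) -> w = 0) /\
  (forall x : 'rV_N, one_arm ar (x 0) -> x *m B = 0 -> x = 0).

(** A is any morphism, not assumed invertible: the block cut out of an isomorphism of larger
    configurations is only known to have a left inverse, and a zero column refutes exactly that. *)
Definition no_iso N s (ar : nat -> nat) (lo : nat -> nat -> bool)
    (B B' : 'M[K]_(N, s)) : Prop :=
  forall (A : 'M_N) (C : 'M_s),
    (forall i j : 'I_N, ar i != ar j -> A i j = 0) ->
    (forall i j : 'I_N, lo i j -> A i j = 0) ->
    A *m B = B' *m C -> exists j, forall i, A i j = 0.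

Variables (n N s e : nat) (io : 'I_N -> 'I_n) (ka : 'I_e -> 'I_n).
Hypotheses (io_inj : injective io) (ka_inj : injective ka).
Hypothesis (io_ka : forall i j, io i != ka j).

(** The coordinates [io] carry the model and the lines [ka] are added to U. Coordinates in neither
    image are lines meeting U in 0. *)
Definition extend (B : 'M[K]_(N, s)) : 'M[K]_(n, s + e) :=
  row_mx ((\matrix_(k, i) (k == io i)%:R) *m B) (\matrix_(k, j) (k == ka j)%:R).

Lemma extend_io B i (j : 'I_s) : extend B (io i) (lshift e j) = B i j.
Proof.
rewrite row_mxEl mxE (bigD1 i) //= mxE eqxx mul1r big1 ?addr0 // => i' ne.
by rewrite mxE (inj_eq io_inj) eq_sym (negPf ne) mul0r.
Qed.

Lemma extend_ioR B i (j : 'I_e) : extend B (io i) (rshift s j) = 0.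
Proof. by rewrite row_mxEr mxE (negPf (io_ka _ _)). Qed.

Lemma extend_ka B i (j : 'I_s) : extend B (ka i) (lshift e j) = 0.
Proof.
rewrite row_mxEl mxE big1 // => i' _.
by rewrite mxE eq_sym (negPf (io_ka _ _)) mul0r.
Qed.

Lemma extend_kaR B i (j : 'I_e) : extend B (ka i) (rshift s j) = (i == j)%:R.
Proof. by rewrite row_mxEr mxE (inj_eq ka_inj). Qed.

Lemma extend_out B k j :
  (forall i, k != io i) -> (forall i, k != ka i) -> extend B k j = 0.
Proof.
move=> kio kka; case: (splitP j) => j' jE.
  rewrite (_ : j = lshift e j') ?row_mxEl; last exact: val_inj.
  by rewrite mxE big1 // => i' _; rewrite mxE (negPf (kio _)) mul0r.
rewrite (_ : j = rshift s j') ?row_mxEr; last exact: val_inj.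
by rewrite mxE (negPf (kka _)).
Qed.

Lemma extend_ioE B i (f : 'I_(s + e) -> K) :
  \sum_j extend B (io i) j * f j = \sum_j B i j * f (lshift e j).
Proof.
rewrite big_split_ord /= [X in _ + X]big1 ?addr0 => [|j _].
  by apply: eq_bigr => j _; rewrite extend_io.
by rewrite extend_ioR mul0r.
Qed.

Lemma mul_extend (g : 'M[K]_n) B k j :
  (g *m extend B) k (lshift e j) = \sum_i g k (io i) * B i j.
Proof.
rewrite /extend mul_mx_row row_mxEl mulmxA mxE; apply: eq_bigr => i _; congr (_ * _).
rewrite mxE (bigD1 (io i)) //= mxE eqxx mulr1 big1 ?addr0 // => l ne.
by rewrite mxE (negPf ne) mulr0.
Qed.

Lemma mul_extendR (g : 'M[K]_n) B k j :
  (g *m extend B) k (rshift s j) = g k (ka j).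
Proof.
rewrite /extend mul_mx_row row_mxEr mxE (bigD1 (ka j)) //= mxE eqxx mulr1 big1 ?addr0 //.
by move=> l ne; rewrite mxE (negPf ne) mulr0.
Qed.

Lemma extend_inj ar B w : generic ar B -> extend B *m w = 0 -> w = 0 :> 'cV_(s + e).
Proof.
move=> [gen _] Pw.
have d0 : dsubmx w = 0.
  apply/colP => j; have := congr1 (fun M : 'cV_n => M (ka j) 0) Pw.
  rewrite !mxE big_split_ord /= big1 ?add0r => [|i _]; last first.
    by rewrite extend_ka mul0r.
  rewrite (bigD1 j) //= extend_kaR eqxx mul1r big1 ?addr0 // => i ne.
  by rewrite extend_kaR eq_sym (negPf ne) mul0r.
have Bu : B *m usubmx w = 0.
  apply/colP => i; have := congr1 (fun M : 'cV_n => M (io i) 0) Pw.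
  rewrite !mxE extend_ioE => h; rewrite -[RHS]h.
  by apply: eq_bigr => j _; rewrite mxE.
have u0 : usubmx w = 0 by apply: gen => i j; rewrite Bu mxE eqxx.
by rewrite -[w]vsubmxK u0 d0 col_mx0.
Qed.

(* The part of [g] on the coordinates [io] still has a left inverse: entries of
   [h] from the coordinates [ka] to [io], and of [g] from [io] to the remaining
   coordinates, vanish by genericity. *)
Lemma restrict_iso ar (lo : nat -> nat -> bool) (B B' : 'M[K]_(N, s))
    (g h : 'M[K]_n) C C' :
  generic ar B -> h *m g = 1%:M ->
  g *m extend B = extend B' *m C -> h *m extend B' = extend B *m C' ->
  (forall k, one_arm ar (fun i => h (io i) k)) ->
  (forall k, one_arm ar (fun i => g k (io i))) ->
  (forall i j : 'I_N, ar i != ar j -> g (io i) (io j) = 0) ->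
  (forall i j : 'I_N, lo i j -> g (io i) (io j) = 0) ->
  no_iso ar lo B B' -> False.
Proof.
move=> [gen1 gen2] hg gB hB' harm garm gar glo.
have h0 i k : h (io i) (ka k) = 0.
  pose w := \col_j C' (lshift e j) (rshift s k).
  have Bw l : (B *m w) l 0 = h (io l) (ka k).
    rewrite -(mul_extendR h B') hB' !mxE extend_ioE.
    by apply: eq_bigr => j _; rewrite mxE.
  have w0 : w = 0 by apply: gen1 => l m; rewrite !Bw; apply: harm.
  by rewrite -Bw w0 mulmx0 mxE.
have g0 k i : (forall i, k != io i) -> (forall i, k != ka i) -> g k (io i) = 0.
  move=> kio kka; pose x := \row_j g k (io j).
  suff x0 : x = 0 by have := congr1 (fun M : 'rV_N => M 0 i) x0; rewrite !mxE.
  apply: gen2 => [l m|]; first by rewrite !mxE; apply: garm.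
  apply/rowP => j; rewrite !mxE.
  transitivity ((g *m extend B) k (lshift e j)).
    by rewrite mul_extend; apply: eq_bigr => l _; rewrite mxE.
  by rewrite gB mxE big1 // => l _; rewrite extend_out ?mul0r.
move=> /(_ (mxsub io io g) (ulsubmx C)) [].
- by move=> i j /gar; rewrite mxE.
- by move=> i j /glo; rewrite mxE.
- apply/matrixP => i j; transitivity ((g *m extend B) (io i) (lshift e j)).
    by rewrite mul_extend mxE; apply: eq_bigr => l _; rewrite mxE.
  by rewrite gB !mxE extend_ioE; apply: eq_bigr => l _; rewrite !mxE.
move=> j A0.
have := congr1 (fun M : 'M_n => M (io j) (io j)) hg.
rewrite !mxE eqxx big1 => [/esym/eqP|k _]; first by rewrite oner_eq0.
case: (pickP (fun i => k == io i)) => [i /eqP->|kio].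
  by have := A0 i; rewrite mxE => ->; rewrite mulr0.
case: (pickP (fun i => k == ka i)) => [i /eqP->|kka]; first by rewrite h0 mul0r.
by rewrite g0 ?mulr0 // => i; rewrite ?kio ?kka.
Qed.

End Restriction.

(** * The one-parameter families *)

Section Models.

Local Open Scope ring_scope.
Variable K : fieldType.
Implicit Types (rows : seq (seq K)) (ar : nat -> nat).

Definition rows_mx N s rows : 'M[K]_(N, s) := \matrix_(i, j) (nth [::] rows i)`_j.

Lemma one_armP N ar (v : 'I_N -> K) : one_arm ar v ->
  exists al, forall i : 'I_N, ar i != al -> v i = 0.
Proof.
move=> one; case: (pickP (fun i => v i != 0)) => [i vi|v0].
  exists (ar i) => j ne; apply/eqP; apply: contraNT ne => vj.
  by rewrite (one j i).
by exists 0%N => j _; apply/eqP/negbFE/v0.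
Qed.

(** In this form a sum of concrete length simplifies to explicit terms, so that the matrix
    conditions become scalar equations. *)
Lemma sum_iota n (F : 'I_n.+1 -> K) :
  \sum_i F i = foldr (fun i x => F (inord i) + x) 0 (iota 0 n.+1).
Proof.
transitivity (\sum_(0 <= i < n.+1) F (inord i)).
  by rewrite big_mkord; apply: eq_bigr => i _; rewrite inord_val.
by rewrite unlock /index_iota subn0.
Qed.

Lemma eq_foldr_iota n (F G : nat -> K) : (forall i, (i < n)%N -> F i = G i) ->
  foldr (fun i x => F i + x) 0 (iota 0 n) = foldr (fun i x => G i + x) 0 (iota 0 n).
Proof.
move=> FG; have : all (fun i => i < n)%N (iota 0 n).
  by apply/allP => i; rewrite mem_iota.
by elim: (iota 0 n) => //= i r IH /andP[/FG-> /IH->].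
Qed.

Lemma generic_rows N s ar rows :
  (forall al (w : nat -> K),
    (forall i, (i <= N)%N -> ar i != al ->
      foldr (fun j x => (nth [::] rows i)`_j * w j + x) 0 (iota 0 s.+1) = 0) ->
    forall j, (j <= s)%N -> w j = 0) ->
  (forall al (x : nat -> K), (forall i, (i <= N)%N -> ar i != al -> x i = 0) ->
    (forall j, (j <= s)%N ->
      foldr (fun i y => x i * (nth [::] rows i)`_j + y) 0 (iota 0 N.+1) = 0) ->
    forall i, (i <= N)%N -> x i = 0) ->
  generic ar (rows_mx N.+1 s.+1 rows).
Proof.
move=> g1 g2; split=> [w /one_armP[al w0]|x /one_armP[al x0] xB].
  apply/colP => j; rewrite [RHS]mxE -[j]inord_val.
  apply: (g1 al (fun j => w (inord j) 0)) => [i iN ar_i|]; last by rewrite -ltnS.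
  have := w0 (inord i); rewrite inordK // => /(_ ar_i) h; rewrite -[RHS]h.
  rewrite mxE sum_iota; apply: eq_foldr_iota => k ks.
  by rewrite mxE !inordK.
apply/rowP => i; rewrite [RHS]mxE -[i]inord_val.
apply: (g2 al (fun i => x 0 (inord i))) => [k kN ar_k|j js|].
- by apply: x0; rewrite inordK.
- have := congr1 (fun M : 'rV_s.+1 => M 0 (inord j)) xB; rewrite [RHS]mxE => h.
  rewrite -[RHS]h.
  rewrite mxE sum_iota; apply: eq_foldr_iota => k ks.
  by rewrite mxE !inordK.
- by rewrite -ltnS.
Qed.

Definition forbidden ar (lo : nat -> nat -> bool) (i j : nat) : bool :=
  (ar i != ar j) || lo i j.

(* Restricting the sum over [k] to the entries of row [i] that may be nonzero keeps
   the expanded equations small. *)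
Lemma no_iso_rows N s ar (lo : nat -> nat -> bool) rows rows' :
  (forall A C : nat -> nat -> K,
    (forall i j, (i <= N)%N -> (j <= N)%N -> forbidden ar lo i j -> A i j = 0) ->
    (forall i j r, (i <= N)%N -> (j <= s)%N ->
      [seq k <- iota 0 N.+1 | ~~ forbidden ar lo i k] = r ->
      foldr (fun k x => A i k * (nth [::] rows k)`_j + x) 0 r =
      foldr (fun k x => (nth [::] rows' i)`_k * C k j + x) 0 (iota 0 s.+1)) ->
    exists2 j, (j <= N)%N & forall i, (i <= N)%N -> A i j = 0) ->
  no_iso ar lo (rows_mx N.+1 s.+1 rows) (rows_mx N.+1 s.+1 rows').
Proof.
move=> H A C Aar Alo AB; pose A' i j := A (inord i) (inord j).
have A'0 i j : (i <= N)%N -> (j <= N)%N -> forbidden ar lo i j -> A' i j = 0.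
  by move=> iN jN /orP[ne|l]; [apply: Aar | apply: Alo]; rewrite !inordK.
have [//|i j _ iN js <-|j jN Aj] := H A' (fun i j => C (inord i) (inord j)).
  have := congr1 (fun M : 'M_(N.+1, s.+1) => M (inord i) (inord j)) AB.
  rewrite !mxE !sum_iota => h; etransitivity; [|etransitivity; [exact: h|]].
    transitivity (foldr (fun k x => A' i k * (nth [::] rows k)`_j + x) 0
                    (iota 0 N.+1)).
      have : all (fun k => k < N.+1)%N (iota 0 N.+1).
        by apply/allP => k; rewrite mem_iota.
      elim: (iota 0 N.+1) => //= k r IH /andP[kN /IH {}IH].
      by case: (boolP (forbidden ar lo i k)) => [/(A'0 _ _ iN kN) ->|_] /=;
        rewrite IH ?mul0r ?add0r.
    by apply: eq_foldr_iota => k kN; rewrite mxE !inordK.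
  by apply: eq_foldr_iota => k ks; rewrite mxE !inordK.
by exists (inord j) => i; have := Aj i; rewrite /A' inord_val -ltnS => ->.
Qed.

Definition arm_of (na nb i : nat) : nat := ((na <= i) + (na + nb <= i))%N.

(* Coordinates come arm by arm ([na], [nb], then the rest), each arm in blocks of
   width [va], [vb], [vc], one per step of its flag; [below] says that row [i] lies
   in a later block than column [j]. *)
Definition below (va vb vc na nb i j : nat) : bool :=
  if (i < na)%N then (j %/ va < i %/ va)%N
  else if (i < na + nb)%N then ((j - na) %/ vb < (i - na) %/ vb)%N
  else ((j - (na + nb)) %/ vc < (i - (na + nb)) %/ vc)%N.

(* Each row gives one coordinate of K^n, restricted to U, as a linear form on U.
   In [rows6] and [rows7] the flags of two arms (or the three lines of [rows6])
   reduce the automorphisms of U to diagonal ones, and [t] is a cross-ratio. In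
   [rows8] they are reduced to three triangular 2 x 2 blocks; the first three rows
   are the columns of [rows6]. *)
Definition rows6 (t : K) : seq (seq K) :=
  [:: [:: 0; 1; t]; [:: 1; 0; 0];
      [:: 1; 0; 1]; [:: 0; 1; 0];
      [:: 1; 1; 0]; [:: 0; 0; 1]].

Definition rows7 (t : K) : seq (seq K) :=
  [:: [:: 1; 0; 1; 1]; [:: 0; 1; 1; t];
      [:: 0; 0; 1; 0]; [:: 0; 1; 0; 0]; [:: 1; 0; 0; 0];
      [:: 0; 1; 0; 0]; [:: 0; 0; 1; 0]; [:: 0; 0; 0; 1]].

Definition rows8 (t : K) : seq (seq K) :=
  [:: [:: 0; 1; 1; 0; 1; 0]; [:: 1; 0; 0; 1; 1; 0]; [:: t; 0; 1; 0; 0; 1];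
      [:: 0; 0; 1; 0; 0; 0]; [:: 0; 0; 0; 1; 0; 0];
      [:: 0; 0; 0; 0; 1; 0]; [:: 0; 0; 0; 0; 0; 1];
      [:: 0; 0; 0; 0; 1; 0]; [:: 0; 0; 0; 1; 0; 0]; [:: 0; 0; 1; 0; 0; 0];
      [:: 0; 1; 0; 0; 0; 0]; [:: 1; 0; 0; 0; 0; 0]].

Ltac drop_zeros := repeat match goal with
  | H : context [(0 + _)%R] |- _ => rewrite add0r in H
  | H : context [(_ + 0)%R] |- _ => rewrite addr0 in H
  | H : context [(0 * _)%R] |- _ => rewrite mul0r in H
  | H : context [(_ * 0)%R] |- _ => rewrite mulr0 in H
  | H : context [(1 * _)%R] |- _ => rewrite mul1r in H
  | H : context [(_ * 1)%R] |- _ => rewrite mulr1 in H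
  end.

(** Substitution suffices for the genericity systems: some remaining equation always has a single
    unknown. *)
Ltac solve_zeros w := repeat (drop_zeros; match goal with
  | H : w ?i = 0, H' : context [w ?i] |- _ =>
      tryif constr_eq H H' then fail else rewrite H in H'
  | H : w ?i = 0 |- context [w ?i] => rewrite H
  end); repeat split.

Ltac use_rows H n :=
  lazymatch n with
  | 0%N => idtac
  | S ?m => (try (generalize (H m isT isT); move=> /= ?)); use_rows H m
  end.

Ltac use_cols E n :=
  lazymatch n with
  | 0%N => idtac
  | S ?m => (generalize (E m isT); move=> /= ?); use_cols E m
  end.

Lemma generic6 t : generic (arm_of 2 2) (rows_mx 6 3 (rows6 t)).
Proof.
apply: generic_rows => al => [w H|x H E].
  have [] : [/\ w 0%N = 0, w 1%N = 0 & w 2%N = 0].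
    case: al H => [|[|[|al]]] H; use_rows H 6%N; clear H; solve_zeros w.
  by move=> ? ? ? [|[|[|]]].
have [] : [/\ x 0%N = 0, x 1%N = 0, x 2%N = 0, x 3%N = 0 & x 4%N = 0 /\ x 5%N = 0].
  by use_cols E 3%N; case: al H => [|[|[|al]]] H; use_rows H 6%N;
    clear H E; solve_zeros x.
by move=> ? ? ? ? [? ?] [|[|[|[|[|[|]]]]]].
Qed.

Lemma generic7 t : generic (arm_of 2 3) (rows_mx 8 4 (rows7 t)).
Proof.
apply: generic_rows => al => [w H|x H E].
  have [] : [/\ w 0%N = 0, w 1%N = 0, w 2%N = 0 & w 3%N = 0].
    by case: al H => [|[|[|al]]] H; use_rows H 8%N; clear H; solve_zeros w.
  by move=> ? ? ? ? [|[|[|[|]]]].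
have [] : [/\ x 0%N = 0, x 1%N = 0, x 2%N = 0 & x 3%N = 0] /\
          [/\ x 4%N = 0, x 5%N = 0, x 6%N = 0 & x 7%N = 0].
  by use_cols E 4%N; case: al H => [|[|[|al]]] H; use_rows H 8%N;
    clear H E; solve_zeros x.
by move=> [? ? ? ?] [? ? ? ?] [|[|[|[|[|[|[|[|]]]]]]]].
Qed.

Lemma generic8 t : generic (arm_of 3 4) (rows_mx 12 6 (rows8 t)).
Proof.
apply: generic_rows => al => [w H|x H E].
  have [] : [/\ w 0%N = 0, w 1%N = 0 & w 2%N = 0] /\
            [/\ w 3%N = 0, w 4%N = 0 & w 5%N = 0].
    by case: al H => [|[|[|al]]] H; use_rows H 12%N; clear H; solve_zeros w.
  by move=> [? ? ?] [? ? ?] [|[|[|[|[|[|]]]]]].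
have [] : [/\ x 0%N = 0, x 1%N = 0, x 2%N = 0 & x 3%N = 0] /\
          [/\ x 4%N = 0, x 5%N = 0, x 6%N = 0 & x 7%N = 0] /\
          [/\ x 8%N = 0, x 9%N = 0, x 10%N = 0 & x 11%N = 0].
  by use_cols E 6%N; case: al H => [|[|[|al]]] H; use_rows H 12%N;
    clear H E; solve_zeros x.
by move=> [? ? ? ?] [[? ? ? ?] [? ? ? ?]]
  [|[|[|[|[|[|[|[|[|[|[|[|]]]]]]]]]]]].
Qed.

Lemma scale_neq t u (a : K) : t != u -> a * t = u * a -> a = 0.
Proof.
move=> tu h; apply/eqP; have : (t - u) * a == 0.
  by rewrite mulrBl mulrC h subrr.
by rewrite mulf_eq0 subr_eq0 (negPf tu).
Qed.

Ltac use_entries E bad N n m :=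
  lazymatch n with
  | 0%N => idtac
  | S ?n' =>
    (let r := eval vm_compute in [seq k <- iota 0 N | ~~ bad n' k] in
     let rec cols k := lazymatch k with
       | 0%N => idtac
       | S ?k' => (let h := fresh in
           generalize (E n' k' r isT isT erefl); move=> /= h;
           rewrite ?(mulr0, mulr1, mul0r, mul1r, addr0, add0r) in h; cols k')
       end in cols m); use_entries E bad N n' m
  end.

Ltac solve_entries A C := repeat (drop_zeros; match goal with
  | H : _ = C ?i ?j, H' : context [C ?i ?j] |- _ =>
      tryif constr_eq H H' then fail else rewrite -H in H'
  | H : A ?i ?j = 0, H' : context [A ?i ?j] |- _ =>
      tryif constr_eq H H' then fail else rewrite H in H'
  | H : 0 = A ?i ?j, H' : context [A ?i ?j] |- _ =>
      tryif constr_eq H H' then fail else rewrite -H in H'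
  | H : A ?i ?j = 0 |- context [A ?i ?j] => rewrite H
  | H : 0 = A ?i ?j |- context [A ?i ?j] => rewrite -H
  | H : A ?i ?j = A _ _, H' : context [A ?i ?j] |- _ =>
      tryif constr_eq H H' then fail else rewrite H in H'
  | H : A ?i ?j = A _ _ |- context [A ?i ?j] => rewrite H
  end).

(** Elimination identifies the surviving entries of [A] with one another, up to
    [A 0 0 * t = u * A 0 0]; hence [A 0 0 = 0], and arms and flags annihilate the rest of column
    0. *)
Lemma no_iso6 t u : t != u ->
  no_iso (arm_of 2 2) (below 1 1 1 2 2)
    (rows_mx 6 3 (rows6 t)) (rows_mx 6 3 (rows6 u)).
Proof.
move=> tu; apply: no_iso_rows => A C Z E.
have A0 : A 0%N 0%N = 0.
  use_entries E (forbidden (arm_of 2 2) (below 1 1 1 2 2)) 6%N 6%N 3%N;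
  clear E; solve_entries A C.
  by match goal with H : _ * t = u * _ |- _ => exact: scale_neq tu H end.
exists 0%N => // -[|i] // iN;
  by apply: Z => //; case: i iN => [|[|[|[|[|]]]]].
Qed.

Lemma no_iso7 t u : t != u ->
  no_iso (arm_of 2 3) (below 2 1 1 2 3)
    (rows_mx 8 4 (rows7 t)) (rows_mx 8 4 (rows7 u)).
Proof.
move=> tu; apply: no_iso_rows => A C Z E.
(* Coordinates 0 and 1 share a block of width 2, so the flag does not annihilate [A 1 0]; the
   equations do. *)
have [A0 A1] : A 0%N 0%N = 0 /\ A 1%N 0%N = 0.
  use_entries E (forbidden (arm_of 2 3) (below 2 1 1 2 3)) 8%N 8%N 4%N;
  clear E; solve_entries A C.
  split; last by [].
  by match goal with H : _ * t = u * _ |- _ => exact: scale_neq tu H end.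
exists 0%N => // -[|[|i]] // iN;
  by apply: Z => //; case: i iN => [|[|[|[|[|[|]]]]]].
Qed.

Lemma no_iso8 t u : t != u ->
  no_iso (arm_of 3 4) (below 3 2 1 3 4)
    (rows_mx 12 6 (rows8 t)) (rows_mx 12 6 (rows8 u)).
Proof.
move=> tu; apply: no_iso_rows => A C Z E.
have [A0 A1 A2] : [/\ A 0%N 0%N = 0, A 1%N 0%N = 0 & A 2%N 0%N = 0].
  use_entries E (forbidden (arm_of 3 4) (below 3 2 1 3 4)) 12%N 12%N 6%N;
  clear E; solve_entries A C.
  split; try by [].
  by match goal with H : _ * t = u * _ |- _ => exact: scale_neq tu H end.
exists 0%N => // -[|[|[|i]]] // iN;
  by apply: Z => //; case: i iN => [|[|[|[|[|[|[|[|[|]]]]]]]]].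
Qed.

End Models.

(** * Placing a model on the coordinates of the three arms *)

Definition cut (x : seq nat) (m : nat) : Prop :=
  exists2 i, i <= size x & m = sumn (take i x).

Lemma cut_cons y x m : cut x m -> cut (y :: x) (y + m).
Proof. by case=> i ix ->; exists i.+1. Qed.

(** Each block of the model takes the first v coordinates of a flag step of dimension at least v.
    Distinct blocks use distinct steps, hence are separated by the dimension of a flag subspace,
    which is what [cut] records. *)
Lemma block_embedding x k v : 0 < v -> k <= count (leq v) x ->
  exists f : nat -> nat,
    [/\ forall i, i < k * v -> f i < sumn x,
        forall i j, i < k * v -> j < k * v -> f i = f j -> i = j
      & forall i j, i < k * v -> j < k * v -> j %/ v < i %/ v ->
          exists2 m, cut x m & f j < m <= f i].
Proof.
move=> v0; elim: x k => [|y x IH] k /=.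
  by rewrite leqn0 => /eqP->; exists id; split.
case: (leqP v y) => vy; last first.
  rewrite add0n => /IH[f [f1 f2 f3]]; exists (fun i => y + f i); split.
  - by move=> i /f1; rewrite ltn_add2l.
  - by move=> i j ik jk /addnI; apply: f2.
  - move=> i j ik jk /(f3 _ _ ik jk)[m mx fm]; exists (y + m).
      exact: cut_cons.
    by rewrite ltn_add2l leq_add2l.
case: k => [_|k]; first by exists id; split.
rewrite add1n ltnS => /IH[f [f1 f2 f3]].
exists (fun i => if i < v then i else y + f (i - v)); split.
- move=> i; rewrite mulSn; case: (ltnP i v) => iv ik; first by lia.
  by rewrite ltn_add2l f1 //; lia.
- move=> i j; rewrite mulSn => ik jk.
  case: (ltnP i v) => iv; case: (ltnP j v) => jv; try lia.
  by move=> /addnI /f2 h; have := h ltac:(lia) ltac:(lia); lia.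
- move=> i j; rewrite mulSn => ik jk.
  case: (ltnP i v) => iv; first by rewrite [i %/ v]divn_small.
  case: (ltnP j v) => jv.
    move=> _; exists y; last by rewrite (leq_trans jv vy) leq_addr.
    by exists 1 => //=; rewrite take0 addn0.
  rewrite -{1}(subnKC iv) -{1}(subnKC jv) !divnDl // !divnn v0 ltn_add2l.
  move=> /f3[]; [by lia | by lia |] => m mx fm.
  exists (y + m); first exact: cut_cons.
  by rewrite ltn_add2l leq_add2l.
Qed.

Definition segment (o : nat) (x : seq nat) (k : nat) : bool :=
  o <= k < o + sumn x.

(** Offsets and tuples are arbitrary up to disjointness of the segments, so that one statement
    serves all six orders of the arms in [tame]. *)
Lemma arm_embedding (o : nat -> nat) (x : nat -> seq nat) ka va kb vb kc vc :
  0 < va -> 0 < vb -> 0 < vc ->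
  ka <= count (leq va) (x 0) -> kb <= count (leq vb) (x 1) ->
  kc <= count (leq vc) (x 2) ->
  (forall al be k, segment (o al) (x al) k -> segment (o be) (x be) k -> al = be) ->
  let na := ka * va in let nb := kb * vb in let N := na + nb + kc * vc in
  let ar := arm_of na nb in
  exists io : nat -> nat,
    [/\ forall i, i < N -> segment (o (ar i)) (x (ar i)) (io i),
        forall i j, i < N -> j < N -> io i = io j -> i = j
      & forall i j, i < N -> j < N -> ar i = ar j -> below va vb vc na nb i j ->
          exists2 m, cut (x (ar i)) m & io j < o (ar i) + m <= io i].
Proof.
move=> va0 vb0 vc0 /(block_embedding va0)[fa [a1 a2 a3]].
move=> /(block_embedding vb0)[fb [b1 b2 b3]].
move=> /(block_embedding vc0)[fc [c1 c2 c3]] disj na nb N ar.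
pose io i := if i < na then o 0 + fa i else
  if i < na + nb then o 1 + fb (i - na) else o 2 + fc (i - (na + nb)).
have ar0 i : i < na -> ar i = 0 by rewrite /ar /arm_of; lia.
have ar1 i : na <= i -> i < na + nb -> ar i = 1 by rewrite /ar /arm_of; lia.
have ar2 i : na + nb <= i -> ar i = 2 by rewrite /ar /arm_of; lia.
have seg i : i < N -> segment (o (ar i)) (x (ar i)) (io i).
  move=> iN; rewrite /io /segment; case: (ltnP i na) => ia.
    by rewrite ar0 // leq_addr ltn_add2l a1.
  case: (ltnP i (na + nb)) => ib; first by rewrite ar1 // leq_addr ltn_add2l b1 //; lia.
  by rewrite ar2 // leq_addr ltn_add2l c1 //; lia.
exists io; split=> // i j iN jN.
  move=> e; have := seg _ jN; rewrite -e => /(disj _ _ _ (seg _ iN)).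
  move: e; rewrite /io; case: (ltnP i na) => ia.
    case: (ltnP j na) => ja; first by move=> /addnI /a2 ->.
    by rewrite ar0 // /ar /arm_of; lia.
  case: (ltnP i (na + nb)) => ib.
    rewrite ar1 //; case: (ltnP j na) => ja; first by rewrite ar0.
    case: (ltnP j (na + nb)) => jb; last by rewrite ar2.
    by move=> /addnI /b2 h _; have := h ltac:(lia) ltac:(lia); lia.
  rewrite ar2 //; case: (ltnP j na) => ja; first by rewrite ar0.
  case: (ltnP j (na + nb)) => jb; first by rewrite ar1.
  by move=> /addnI /c2 h _; have := h ltac:(lia) ltac:(lia); lia.
rewrite /io /below; case: (ltnP i na) => ia.
  rewrite (ar0 i) //; case: (ltnP j na) => ja; last by rewrite /ar /arm_of; lia.
  by move=> _ /(a3 _ _ ia ja)[m ? ?]; exists m; rewrite // ltn_add2l leq_add2l.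
case: (ltnP i (na + nb)) => ib.
  rewrite (ar1 i) //; case: (ltnP j na) => ja; first by rewrite ar0.
  case: (ltnP j (na + nb)) => jb; last by rewrite ar2.
  move=> _ /b3[]; [by lia | by lia |] => m ? ?.
  by exists m; rewrite // ltn_add2l leq_add2l.
rewrite (ar2 i) //; case: (ltnP j na) => ja; first by rewrite ar0.
case: (ltnP j (na + nb)) => jb; first by rewrite ar1.
move=> _ /c3[]; [by lia | by lia |] => m ? ?.
by exists m; rewrite // ltn_add2l leq_add2l.
Qed.

Section Arms.

Local Open Scope ring_scope.
Variable K : fieldType.

Definition armed n (g : 'M[K]_n) (o : nat) (x : seq nat) : Prop :=
  (forall k l : 'I_n, segment o x k != segment o x l -> g k l = 0) /\
  (forall (k l : 'I_n) m, cut x m -> segment o x k -> segment o x l ->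
     (l < o + m <= k)%N -> g k l = 0).

(** The column spaces of the [P t] are d-dimensional and pairwise inequivalent under the stabilizer
    of the standard flags. *)
Definition separated n d (o : nat -> nat) (x : nat -> seq nat) : Prop :=
  exists P : K -> 'M[K]_(n, d),
    (forall t (w : 'cV_d), P t *m w = 0 -> w = 0) /\
    forall t u (g h : 'M[K]_n) C C', h *m g = 1%:M ->
      (forall al, (al < 3)%N -> armed g (o al) (x al)) ->
      (forall al, (al < 3)%N -> armed h (o al) (x al)) ->
      g *m P t = P u *m C -> h *m P u = P t *m C' -> t = u.

Lemma complement_injection n N e (io : 'I_N -> 'I_n) : (N + e <= n)%N ->
  exists2 kap : 'I_e -> 'I_n, injective kap & forall i j, io i != kap j.
Proof.
move=> Nen; have le : (e <= #|~: [set io i | i : 'I_N]|)%N.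
  rewrite cardsCs setCK card_ord leq_subRL.
    rewrite (leq_trans _ Nen) // leq_add2r.
    by rewrite (leq_trans (leq_imset_card _ _)) ?card_ord.
  by rewrite (leq_trans (leq_imset_card _ _)) ?card_ord //; lia.
exists (fun j => enum_val (widen_ord le j)).
  by move=> i j /enum_val_inj /(congr1 val) /= /val_inj.
move=> i j; apply/eqP => ij; have := enum_valP (widen_ord le j).
by rewrite -ij inE imset_f.
Qed.

(** The model contributes s to dim U = d; the other d - s dimensions are coordinate lines off the N
    model coordinates, which needs N + (d - s) <= n. The three models have N = 2s, so the condition
    is s <= min(d, n - d), as in [null]. *)
Lemma separated_model n d o x ka va kb vb kc vc N s (B : K -> 'M[K]_(N, s)) :
  (0 < va)%N -> (0 < vb)%N -> (0 < vc)%N ->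
  (ka <= count (leq va) (x 0%N))%N -> (kb <= count (leq vb) (x 1%N))%N ->
  (kc <= count (leq vc) (x 2%N))%N ->
  (forall al be k, segment (o al) (x al) k -> segment (o be) (x be) k -> al = be) ->
  (forall al, (al < 3)%N -> (o al + sumn (x al) <= n)%N) ->
  N = (ka * va + kb * vb + kc * vc)%N ->
  (s <= d)%N -> (d + N <= n + s)%N ->
  (forall t, generic (arm_of (ka * va) (kb * vb)) (B t)) ->
  (forall t u, t != u ->
    no_iso (arm_of (ka * va) (kb * vb))
      (below va vb vc (ka * va) (kb * vb)) (B t) (B u)) ->
  separated n d o x.
Proof.
move=> va0 vb0 vc0 xa xb xc disj xn NE sd dN gen iso.
have [io [io1 io2 io3]] := arm_embedding va0 vb0 vc0 xa xb xc disj.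
rewrite -NE in io1 io2 io3.
set ar := arm_of _ _ in io1 io3 gen iso.
have ar3 i : (ar i < 3)%N by rewrite /ar /arm_of; lia.
have ion (i : 'I_N) : (io i < n)%N.
  by case/andP: (io1 i (ltn_ord i)) => _ h; apply: leq_trans h (xn _ (ar3 i)).
pose I (i : 'I_N) := Ordinal (ion i).
have I_inj : injective I.
  by move=> i j /(congr1 val) /= h; apply: val_inj; apply: io2 h.
rewrite -(subnKC sd); have [|J J_inj IJ] := @complement_injection n N (d - s) I.
  by lia.
have col (h : 'M[K]_n) k : (forall al, (al < 3)%N -> armed h (o al) (x al)) ->
    one_arm ar (fun i => h (I i) k).
  move=> harm i j hi hj.
  have S l : h (I l) k != 0 -> segment (o (ar l)) (x (ar l)) k.
    move=> hl; have [H _] := harm _ (ar3 l).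
    have := io1 l (ltn_ord l); have := H (I l) k; case: eqP => [<- //|_ H0].
    by rewrite H0 ?eqxx in hl.
  exact: disj (S i hi) (S j hj).
have row (h : 'M[K]_n) k : (forall al, (al < 3)%N -> armed h (o al) (x al)) ->
    one_arm ar (fun i => h k (I i)).
  move=> harm i j hi hj.
  have S l : h k (I l) != 0 -> segment (o (ar l)) (x (ar l)) k.
    move=> hl; have [H _] := harm _ (ar3 l).
    have := io1 l (ltn_ord l); have := H k (I l); case: eqP => [-> //|_ H0].
    by rewrite H0 ?eqxx in hl.
  exact: disj (S i hi) (S j hj).
exists (fun t => extend I J (B t)); split=> [t w|t u g h C C' hg ga ha gP hP].
  exact: extend_inj (gen t).
apply/eqP; apply: contraT => /iso NI; exfalso.
have g0 (i j : 'I_N) : ar i != ar j -> g (I i) (I j) = 0.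
  move=> ne; apply/eqP; apply: contraNT ne => gij; apply/eqP.
  apply: (disj _ _ (I i)); first exact: io1.
  have [H _] := ga _ (ar3 j).
  have := io1 j (ltn_ord j); have := H (I i) (I j); case: eqP => [-> //|_ H0].
  by rewrite H0 ?eqxx in gij.
apply: (restrict_iso I_inj IJ (gen t) hg gP hP _ _ _ _ NI)
  => // [k|k|i j lo].
- exact: col.
- exact: row.
have [e|/g0 //] := eqVneq (ar i) (ar j).
have [m mx lt] := io3 i j (ltn_ord i) (ltn_ord j) e lo.
have [_ H] := ga _ (ar3 i); apply: (H (I i) (I j) m mx) => //; first exact: io1.
by rewrite e; apply: io1.
Qed.

Lemma separated_null n d o x :
  (forall al be k, segment (o al) (x al) k -> segment (o be) (x be) k -> al = be) ->
  (forall al, (al < 3)%N -> (o al + sumn (x al) <= n)%N) -> (d <= n)%N ->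
  null (x 0%N) (x 1%N) (x 2%N) (minn d (n - d)) -> separated n d o x.
Proof.
move=> disj xn dn; rewrite /null.
case/or3P => /and4P[ha hb hc hs].
- by apply: (separated_model (B := fun t => rows_mx 6 3 (rows6 t))
    (va := 1) (vb := 1) (vc := 1) _ _ _ ha hb hc disj xn) => //; try lia;
    [exact: generic6 | exact: no_iso6].
- by apply: (separated_model (B := fun t => rows_mx 8 4 (rows7 t))
    (va := 2) (vb := 1) (vc := 1) _ _ _ ha hb hc disj xn) => //; try lia;
    [exact: generic7 | exact: no_iso7].
- by apply: (separated_model (B := fun t => rows_mx 12 6 (rows8 t))
    (va := 3) (vb := 2) (vc := 1) _ _ _ ha hb hc disj xn) => //; try lia;
    [exact: generic8 | exact: no_iso8].
Qed.

End Arms.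

(** * Infinitely many orbits *)

Section Geometry.

Local Open Scope ring_scope.
Variable K : fieldType.

Definition col_space n m (M : 'M[K]_(n, m)) : {vspace 'cV[K]_n} :=
  limg (linfun (mulmx M : 'cV[K]_m -> 'cV[K]_n)).

Lemma col_spaceP n m (M : 'M[K]_(n, m)) v :
  reflect (exists w, v = M *m w) (v \in col_space M).
Proof.
rewrite /col_space; apply: (iffP memv_imgP) => [[w _ ->]|[w ->]].
  by exists w; rewrite lfunE.
by exists w; rewrite ?memvf ?lfunE.
Qed.

Lemma dim_col_space n m (M : 'M[K]_(n, m)) :
  (forall w : 'cV_m, M *m w = 0 -> w = 0) -> \dim (col_space M) = m.
Proof.
move=> inj; rewrite /col_space limg_dim_eq.
  by rewrite dimvf /dim /= muln1.
apply/eqP; rewrite -subv0; apply/subvP => v.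
rewrite memv_cap memv_ker lfunE /= => /andP[_ /eqP Mv].
by rewrite memv0 (inj v Mv).
Qed.

Lemma mx_imgP n (g : 'M[K]_n) (U : {vspace 'cV[K]_n}) v :
  reflect (exists2 w, w \in U & v = g *m w) (v \in mx_img g U).
Proof.
by rewrite /mx_img; apply: (iffP memv_imgP) => -[w wU ->]; exists w; rewrite // lfunE.
Qed.

Lemma mx_img1 n (U : {vspace 'cV[K]_n}) : mx_img 1%:M U = U.
Proof.
apply/vspaceP => v; apply/mx_imgP/idP => [[w wU ->]|vU]; first by rewrite mul1mx.
by exists v; rewrite ?mul1mx.
Qed.

Lemma mx_img_mul n (g h : 'M[K]_n) U : mx_img g (mx_img h U) = mx_img (g *m h) U.
Proof.
apply/vspaceP => v; apply/mx_imgP/mx_imgP => [[_ /mx_imgP[w wU ->] ->]|[w wU ->]].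
  by exists w; rewrite ?mulmxA.
by exists (h *m w); rewrite ?mulmxA //; apply/mx_imgP; exists w.
Qed.

Lemma mx_img_col_space n m (g : 'M[K]_n) (M M' : 'M[K]_(n, m)) :
  mx_img g (col_space M) = col_space M' -> exists C, g *m M = M' *m C.
Proof.
move=> gM; have h j : exists w : 'cV_m, col j (g *m M) == M' *m w.
  rewrite colE -mulmxA -colE.
  suff /col_spaceP[w ->] : g *m col j M \in col_space M' by exists w.
  rewrite -gM; apply/mx_imgP; exists (col j M) => //.
  by apply/col_spaceP; exists (delta_mx j 0); rewrite colE.
exists (\matrix_(i, j) (xchoose (h j)) i 0); apply/matrixP => i j.
have /eqP := xchooseP (h j) => /(congr1 (fun M : 'cV_n => M i 0)).
rewrite mxE [RHS]mxE => e; etransitivity; [exact: e|].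
by rewrite [RHS]mxE; apply: eq_bigr => l _; rewrite !mxE.
Qed.

Lemma flag_act1 x (F : flag_seq K x) : flag_act 1%:M F = F.
Proof. by apply: val_inj => /=; rewrite (eq_map (@mx_img1 _)) map_id. Qed.

Lemma flag_act_mul x (g h : 'M[K]_(sumn x)) (F : flag_seq K x) :
  flag_act g (flag_act h F) = flag_act (g *m h) F.
Proof.
by apply: val_inj => /=; rewrite -map_comp; apply: eq_map => U /=; rewrite mx_img_mul.
Qed.

Definition std_space (x : seq nat) (i : nat) : {vspace 'cV[K]_(sumn x)} :=
  col_space (pid_mx (sumn (take i x)) : 'M_(sumn x, sumn (take i x))).

Lemma sumn_take x i : (sumn (take i x) <= sumn x)%N.
Proof. by rewrite -{2}[x](cat_take_drop i) sumn_cat leq_addr. Qed.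

Lemma std_spaceP x i (v : 'cV_(sumn x)) :
  reflect (forall k : 'I_(sumn x), (sumn (take i x) <= k)%N -> v k 0 = 0)
    (v \in std_space x i).
Proof.
apply: (iffP (col_spaceP _ _)) => [[w ->] k ik|v0].
  by rewrite mxE big1 // => l _; rewrite mxE ltnNge ik andbF mul0r.
exists (\col_j v (widen_ord (sumn_take x i) j) 0); apply/colP => k; rewrite mxE.
case: (ltnP k (sumn (take i x))) => [ki|ik]; last first.
  by rewrite v0 // big1 // => l _; rewrite mxE ltnNge ik andbF mul0r.
rewrite (bigD1 (Ordinal ki)) //= !mxE eqxx ki mul1r big1 ?addr0 => [|l ne].
  by congr (v _ _); apply: val_inj.
rewrite !mxE (_ : (k == l :> nat) = false) ?mul0r //.
by apply: contra_neqF ne => /eqP kl; apply: val_inj.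
Qed.

Lemma dim_std_space x i : \dim (std_space x i) = sumn (take i x).
Proof.
apply: dim_col_space => w pw; apply/colP => j; rewrite [RHS]mxE.
have := congr1 (fun M : 'cV_(sumn x) => M (widen_ord (sumn_take x i) j) 0) pw.
rewrite [RHS]mxE mxE (bigD1 j) //= mxE /= eqxx ltn_ord mul1r big1 ?addr0 //.
move=> l ne; rewrite mxE /= (_ : (j == l :> nat) = false) ?mul0r //.
by apply: contra_neqF ne => /eqP kl; apply: val_inj.
Qed.

Definition std_flag (x : seq nat) : flag_seq K x :=
  [tuple std_space x i | i < (size x).+1].

Lemma nth_std_flag x i : (i <= size x)%N -> nth 0%VS (std_flag x) i = std_space x i.
Proof.
rewrite -ltnS => ix.
by have := nth_mktuple (fun j : 'I_(size x).+1 => std_space x j) 0%VS (Ordinal ix).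
Qed.

Lemma std_flag_is_flag x : is_flag (std_flag x).
Proof.
split=> [||i ix]; rewrite !nth_std_flag ?(ltnW ix) //.
- by apply/eqP; rewrite -dimv_eq0 dim_std_space take0.
- apply/eqP; rewrite eqEdim subvf dim_std_space dimvf /dim /= muln1.
  by rewrite take_size /=.
- split; last by rewrite !dim_std_space (take_nth 0%N ix) sumn_rcons addKn.
  apply/subvP => v /std_spaceP h; apply/std_spaceP => k ik; apply: h.
  by apply: leq_trans ik; rewrite (take_nth 0%N ix) sumn_rcons leq_addr.
Qed.

Lemma flag_act_std x (g : 'M[K]_(sumn x)) : flag_act g (std_flag x) = std_flag x ->
  forall (k l : 'I_(sumn x)) m, cut x m -> (l < m <= k)%N -> g k l = 0.
Proof.
move=> gF k l m [i ix ->] /andP[lm mk].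
have gi : mx_img g (std_space x i) = std_space x i.
  rewrite -{2}(nth_std_flag ix) -gF (nth_map 0%VS) ?size_tuple //.
  by rewrite nth_std_flag.
have : g *m delta_mx l 0 \in std_space x i.
  rewrite -gi; apply/mx_imgP; exists (delta_mx l 0) => //.
  apply/std_spaceP => j ij; rewrite mxE (_ : (j == l) = false) //.
  by apply/eqP => jl; move: lm; rewrite -jl ltnNge ij.
by move/std_spaceP => /(_ k mk); rewrite -colE mxE.
Qed.

Variable lam : quadruple.

Lemma Lblock_armed (g : Lmx K lam) :
  flag_act g.1.1 (std_flag (chop (qa lam))) = std_flag (chop (qa lam)) ->
  flag_act g.1.2 (std_flag (chop (qb lam))) = std_flag (chop (qb lam)) ->
  flag_act g.2 (std_flag (chop (qc lam))) = std_flag (chop (qc lam)) ->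
  [/\ armed (Lblock g) 0 (chop (qa lam)),
      armed (Lblock g) (sumn (chop (qa lam))) (chop (qb lam))
    & armed (Lblock g) (sumn (chop (qa lam)) + sumn (chop (qb lam)))
        (chop (qc lam))].
Proof.
move=> /flag_act_std ga /flag_act_std gb /flag_act_std gc.
have ord_case (P : 'I_(qsize lam) -> Prop) :
    (forall i, P (lshift _ (lshift _ i))) -> (forall i, P (lshift _ (rshift _ i))) ->
    (forall i, P (rshift _ i)) -> forall k, P k.
  move=> h1 h2 h3 k; rewrite -(splitK k); case: (split k) => [i|i] /=; last exact: h3.
  by rewrite -(splitK i); case: (split i).
split; split.
all: elim/ord_case => i; elim/ord_case => j; rewrite /segment /Lblock /=
  ?block_mxEul ?block_mxEur ?block_mxEdl ?block_mxEdr ?mxE //.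
all: have := ltn_ord i; have := ltn_ord j; rewrite /= => jlt ilt.
all: try lia.
- by move=> m mx _ _ h; apply: ga mx _; lia.
- by move=> m mx _ _ h; apply: gb mx _; lia.
- by move=> m mx _ _ h; apply: gc mx _; lia.
Qed.

End Geometry.

Section FiniteType.

Variables (K : fieldType) (lam : quadruple).

(** With the same flags in all points, an element of L carrying one such point to another stabilizes
    the standard flags. *)
Definition std_point d (P : 'M[K]_(qsize lam, d)) : Defs.point K lam :=
  (std_flag K (chop (qa lam)), std_flag K (chop (qb lam)),
   std_flag K (chop (qc lam)), col_space P).

Lemma std_point_in d (P : 'M[K]_(qsize lam, d)) : d = nth 0 (qd lam) 0 ->
  (forall w : 'cV_d, P *m w = 0 -> w = 0)%R -> Xvar (std_point P).
Proof.
by move=> dE inj; split; rewrite ?dim_col_space //; apply: std_flag_is_flag.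
Qed.

(** Both g and its inverse h are returned with their block shape, because genericity is applied to
    entries of each. *)
Lemma same_orbit d (P Q : 'M[K]_(qsize lam, d)) :
  Lorbit (std_point P) = Lorbit (std_point Q) ->
  exists g h C C', [/\ (h *m g = 1%:M)%R, (g *m P = Q *m C)%R,
    (h *m Q = P *m C')%R
    & forall k : 'M[K]_(qsize lam), k = g \/ k = h ->
      [/\ armed k 0 (chop (qa lam)),
          armed k (sumn (chop (qa lam))) (chop (qb lam))
        & armed k (sumn (chop (qa lam)) + sumn (chop (qb lam)))
            (chop (qc lam))]].
Proof.
move=> PQ; have : Lorbit (std_point Q) (std_point Q).
  exists (1%:M, 1%:M, 1%:M)%R; first by split; apply: unitmx1.
  rewrite /Lact /= !flag_act1 /std_point; congr (_, _).
  by rewrite /Lblock /= -!scalar_mx_block mx_img1.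
rewrite -PQ => -[[[ga gb] gc] [/= ua ub uc]] e.
have ea := congr1 (fun p : Defs.point K lam => p.1.1.1) e.
have eb := congr1 (fun p : Defs.point K lam => p.1.1.2) e.
have ec := congr1 (fun p : Defs.point K lam => p.1.2) e.
have eU := congr1 (fun p : Defs.point K lam => p.2) e.
rewrite /= in ea eb ec eU.
pose g : Lmx K lam := (ga, gb, gc).
pose h : Lmx K lam := (invmx ga, invmx gb, invmx gc).
have hg : (Lblock h *m Lblock g = 1%:M)%R.
  rewrite /Lblock /= !mulmx_block !(mulmx0, mul0mx, addr0, add0r).
  by rewrite !mulVmx // -!scalar_mx_block.
have inv x (k : 'M[K]_(sumn x)) : (k \in unitmx)%R ->
    flag_act k (std_flag K x) = std_flag K x ->
    flag_act (invmx k) (std_flag K x) = std_flag K x.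
  by move=> ku {1}<-; rewrite flag_act_mul mulVmx // flag_act1.
have eV : mx_img (Lblock h) (col_space Q) = col_space P.
  by rewrite -eU mx_img_mul hg mx_img1.
have [C gP] := mx_img_col_space eU; have [C' hQ] := mx_img_col_space eV.
exists (Lblock g), (Lblock h), C, C'; split=> // k [->|->].
  exact: Lblock_armed.
by apply: Lblock_armed; apply: inv.
Qed.

Lemma finite_type_tame : [pchar K]%R =i pred0 -> size (qd lam) = 2 ->
  sumn (qd lam) = qsize lam -> finite_type K lam ->
  tame (chop (qa lam)) (chop (qb lam)) (chop (qc lam))
    (minn (nth 0 (qd lam) 0) (nth 0 (qd lam) 1)).
Proof.
move=> charK dsz dsum fin; apply: contraT; rewrite negbK => wild.
set d := nth 0 (qd lam) 0 in wild *; set d' := nth 0 (qd lam) 1 in wild.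
have dd' : d + d' = qsize lam.
  rewrite -dsum /d /d'; case: (qd lam) dsz => [|? [|? []]] //= _.
  by rewrite addn0.
set a := chop (qa lam) in wild; set b := chop (qb lam) in wild.
set c := chop (qc lam) in wild.
have no_sep o x : (forall al, al < 3 -> exists2 i, i < 3 &
    (o al = nth 0 [:: 0; sumn a; sumn a + sumn b] i) /\ x al = nth [::] [:: a; b; c] i) ->
    ~ separated K (qsize lam) d o x.
  move=> ox [P [inj sep]].
  (* In characteristic zero the natural numbers give infinitely many parameters, so distinct indices
     give distinct orbits. *)
  pose f (i : nat) := Lorbit (std_point (P i%:R%R)).
  have f_inj : injective f.
    move=> i j /same_orbit[g [h [C [C' [hg gP hQ arm]]]]].
    have A k : k = g \/ k = h -> forall al, al < 3 -> armed k (o al) (x al).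
      move=> /arm[h1 h2 h3] al /ox[i0 i3 [-> ->]].
      by case: i0 i3 => [|[|[|]]].
    have ij : (i%:R = j%:R :> K)%R.
      by apply: sep hg (A g _) (A h _) gP hQ; [left | right].
    have nat0 n : (n%:R == 0 :> K)%R = (n == 0) by move: n; apply/pcharf0P.
    wlog le : i j {f g h C C' hg gP hQ arm A} ij / i <= j.
      by move=> W; case/orP: (leq_total i j) => /W ->.
    apply/eqP; rewrite eqn_leq le /= -subn_eq0 -nat0 natrB // ij subrr.
    by [].
  have [] := infinite_nat.
  have -> : [set: nat]%classic = (f @^-1` [set Lorbit p | p in @Xvar K lam])%classic.
    apply/seteqP; split=> // i _; exists (std_point (P i%:R%R)) => //.
    by apply: std_point_in => //; apply: inj.
  by apply: finite_preimage => // i j _ _; apply: f_inj.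
have sN o x : separated K (qsize lam) d o x ->
    (forall al, al < 3 -> exists2 i, i < 3 &
    (o al = nth 0 [:: 0; sumn a; sumn a + sumn b] i) /\ x al = nth [::] [:: a; b; c] i) ->
    false.
  by move=> h1 /no_sep /(_ h1).
have d'E : d' = qsize lam - d by rewrite -dd' addKn.
have dn : d <= qsize lam by rewrite -dd' leq_addr.
have n3 : qsize lam = sumn a + sumn b + sumn c by [].
rewrite d'E in wild.
pose oo (u v w : nat) := nth 0 [:: u; v; w].
pose xx (u v w : seq nat) := nth [::] [:: u; v; w].
have S u v w (x y z : seq nat) : null x y z (minn d (qsize lam - d)) ->
    (forall al be k, segment (oo u v w al) (xx x y z al) k ->
       segment (oo u v w be) (xx x y z be) k -> al = be) ->
    (forall al, al < 3 -> oo u v w al + sumn (xx x y z al) <= qsize lam) ->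
    separated K (qsize lam) d (oo u v w) (xx x y z).
  by move=> nl disj le; apply: separated_null.
case/or4P: wild => [N|N|N|/or3P[N|N|N]];
  [ apply: (sN _ _ (S 0 (sumn a) (sumn a + sumn b) _ _ _ N _ _))
  | apply: (sN _ _ (S 0 (sumn a + sumn b) (sumn a) _ _ _ N _ _))
  | apply: (sN _ _ (S (sumn a) 0 (sumn a + sumn b) _ _ _ N _ _))
  | apply: (sN _ _ (S (sumn a) (sumn a + sumn b) 0 _ _ _ N _ _))
  | apply: (sN _ _ (S (sumn a + sumn b) 0 (sumn a) _ _ _ N _ _))
  | apply: (sN _ _ (S (sumn a + sumn b) (sumn a) 0 _ _ _ N _ _)) ].
all: try by move=> [|[|[|]]] // _; rewrite n3 /oo /xx /=; lia.
(* An index beyond the three arms gets the default offset 0 and the empty tuple, so its segment is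
   empty and disjointness holds vacuously. *)
all: try by move=> [|[|[|al]]] [|[|[|be]]] k;
  rewrite /oo /xx /= /segment //= ?nth_nil /=; lia.
all: rewrite /oo /xx => -[|[|[|]]] // _ /=.
all: by [exists 0 | exists 1 | exists 2].
Qed.

End FiniteType.

Theorem theorem4p1 (K : closedFieldType) (charK0 : [pchar K]%R =i pred0)
  (l1 l2 l3 : nat) (l1_gt0 : 1 <= l1) (l2_gt0 : 1 <= l2) (l3_gt0 : 1 <= l3)
  (lam : quadruple) (lamP : Lambda l1 l2 l3 2 lam)
  (lam_finite : finite_type K lam) (lam_ge1 : 1 <= qsize lam) :
  tits lam = 1%R <-> exists2 mu : quadruple, in_table mu & sim_quadruple lam mu.
Proof.
apply: (tame_tits1 l1_gt0 l2_gt0 l3_gt0 lamP lam_ge1).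
by case: lamP => -[_ _ _ sd] _ [_ _ _ nd]; apply: finite_type_tame lam_finite.
Qed.
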